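(* There exist real numbers $C,d>0$ such that the following holds for every finite field $\mathbb{F}_q$. Let $G=\mathrm{SL}_2(\mathbb{F}_q)$ and let $A\subseteq G$ be a subset generating $G$. Then $$\mathrm{diam}^+(G,A)<C\log^d(|G|),$$ and for every real $\delta>0$, $$|A|>|G|^{\delta}\ \Longrightarrow\ \mathrm{diam}^+(G,A)<C\left(\tfrac{1}{\delta}\right)^d.$$
   Context: For a finite group $G$ and a generating set $S$ of $G$, $\mathrm{diam}^+(G,S)$ is the minimal $k$ such that every element of $G$ is a product of at most $k$ elements of $S$, i.e. $\mathrm{diam}^+(G,S)=\min\{k : (S\cup\{1\})^{(k)}=G\}$, where $B^{(k)}=\{b_1\cdots b_k : b_i\in B\}$. The logarithm is to base $2$ and $\log^d(x)=(\log x)^d$. The constants $C,d$ are absolute (independent of $q$, $A$, $\delta$). *)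

(* Defs.v *)
From HB Require Import structures.
From mathcomp Require Import all_boot all_order all_algebra all_fingroup.
From mathcomp Require Import all_classical all_reals all_analysis.

Set Implicit Arguments.
Unset Strict Implicit.
Unset Printing Implicit Defensive.

Import Order.TTheory GRing.Theory Num.Theory.

Section SL2.
Local Open Scope ring_scope.
Variable F : finFieldType.

Definition SL2_set : {set {'GL_2[F]}} := [set u | \det (GLval u) == 1].

Lemma SL2_group_set : group_set SL2_set.
Proof.
apply/group_setP; split=> [|u v]; rewrite !inE; first by rewrite GL_1E det1.
by move=> /eqP du /eqP dv; rewrite GL_MxE det_mulmx du dv mulr1.
Qed.

Canonical SL2 : {group {'GL_2[F]}} := Group SL2_group_set.

End SL2.

Section Diameter.
Local Open Scope group_scope.
Variables (gT : finGroupType) (G : {group gT}) (S : {set gT}).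

Lemma diam_plus_ex (genS : <<S>> = G) :
  exists k, ((1 |: S) ^+ k == G :> {set gT}).
Proof. by have [k Ek] := gen_expgs S; exists k; rewrite -Ek genS. Qed.

(* The power is taken in the monoid {set gT}: B ^+ k is the set of all
   products b_1 * ... * b_k with every b_i in B. *)
Definition diam_plus (genS : <<S>> = G) : nat := ex_minn (diam_plus_ex genS).

End Diameter.

Definition log2 (R : realType) (x : R) : R := (ln x / ln 2)%R.

(* Main.v *)
(* Let q be the size of the field and B a symmetric generating set of
   G = SL_2(F) containing 1.  A product set of B of bounded length contains an
   element g with trace different from 2 and -2.  The elements of B of a fixed
   such trace number at most O(|B^5|^(2/3)), so orbit-stabiliser gives at least
   about |B|^(1/3) elements of B^2 in the torus C(g).  This lower bound passes
   from a torus to its conjugates by B, hence holds for all the roughly q^2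
   conjugates of C(g); counting B^2 over these tori gives
   q^2 |B|^(1/3) <= O(|B^2|) up to powers of |B^30| / |B|.  So B^30 is larger than
   B by a power, unless |B| is nearly q^3.  Ruzsa's triangle inequality turns
   this into growth of A^3 for an arbitrary generating set A.

   When |A| is nearly q^3, a second moment argument on the projective line puts
   many positive words of A in one Borel subgroup; an energy argument over F
   makes boundedly many of them fill a coset of the unipotent radical, and the
   Bruhat decomposition then gives G.  Iterating A |-> A^m, the number of steps
   needed is logarithmic in log |G| / log |A|, whence the polynomial bound in
   1 / delta; the bound in log |G| is the case delta = 1 / (2 log2 |G|). *)
Require Import Defs.
From mathcomp Require Import all_boot all_order all_algebra all_fingroup.
From mathcomp Require Import ring zify lra.
Set Implicit Arguments.
Unset Strict Implicit.
Unset Printing Implicit Defensive.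
Import Order.TTheory GRing.Theory.

(** * Entries of 2 x 2 matrices *)

(** Two demands shape the argument. The field is arbitrary, so no step may assume 2 invertible or
    pass to the algebraic closure: tori appear only as centralisers, split and nonsplit alike,
    through the transitivity of commuting off the scalars, and a common eigenvector is expressed by
    the vanishing of det (u v - v u). The diameter counts positive words only, so the inverses that
    conjugation and orbit-stabiliser require are confined to the growth step, where Ruzsa's
    inequality removes them; for large sets every word used must be positive. The two regimes are
    made to overlap. With n = |A|, the bound q^6 n^3 <= c N^5 means growth only while n is below q^3
    by a power; it is used for (2 n)^4 <= q^11, while the second moment argument needs n^3 > 32 q^8.
    As 8/3 < 11/4 < 3, one of them applies once q exceeds a constant. Smaller fields and sets of
    bounded size are settled by the strict growth of the powers of a set containing 1 until they
    fill the group. *)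

(* Naming the group keeps unification from unfolding the matrix structures. *)
Definition GL2 (F : finFieldType) : finGroupType := {'GL_2[F]}.

Definition SL2_sub (F : finFieldType) : {group GL2 F} := SL2 F.

Section Entries.
Variable F : finFieldType.
Implicit Types u v : GL2 F.
Local Notation G := (SL2_sub F).
Local Open Scope ring_scope.

Lemma GLvalM u v : GLval (u * v)%g = GLval u *m GLval v.
Proof. exact: GL_MxE. Qed.

Lemma GLval1 : GLval (1%g : GL2 F) = 1.
Proof. exact: GL_1E. Qed.

Definition ea u : F := GLval u 0 0.
Definition eb u : F := GLval u 0 1.
Definition ec u : F := GLval u 1 0.
Definition ed u : F := GLval u 1 1.
Definition tr2 u : F := ea u + ed u.

Definition mx2 (a b c d : F) : 'M[F]_2 :=
  \matrix_(i, j) if i == 0 then if j == 0 then a else b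
                 else if j == 0 then c else d.

Lemma det2E (M : 'M[F]_2) : \det M = M 0 0 * M 1 1 - M 0 1 * M 1 0.
Proof.
rewrite (expand_det_row _ 0) big_ord_recl big_ord1 /cofactor !det_mx11 !mxE /=.
rewrite (_ : lift 0 0 = 1 :> 'I_2); last exact: val_inj.
rewrite (_ : lift 1 0 = 0 :> 'I_2); last exact: val_inj.
by rewrite expr0 expr1; ring.
Qed.

Lemma GL2P u v :
  ea u = ea v -> eb u = eb v -> ec u = ec v -> ed u = ed v -> u = v.
Proof.
move=> ha hb hc hd; apply: val_inj; apply/matrixP => i j.
have I2 (k : 'I_2) : k = 0 \/ k = 1.
  by case: k => [[|[|//]] lt_k]; [left | right]; apply: val_inj.
by case: (I2 i) => ->; case: (I2 j) => ->.
Qed.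

Lemma entriesM u v :
  [/\ ea (u * v)%g = ea u * ea v + eb u * ec v,
      eb (u * v)%g = ea u * eb v + eb u * ed v,
      ec (u * v)%g = ec u * ea v + ed u * ec v
    & ed (u * v)%g = ec u * eb v + ed u * ed v].
Proof.
rewrite /ea /eb /ec /ed !GLvalM !mxE !big_ord_recl !big_ord0 !addr0.
by rewrite (_ : lift 0 0 = 1 :> 'I_2); last exact: val_inj.
Qed.

Lemma eaM u v : ea (u * v)%g = ea u * ea v + eb u * ec v.
Proof. by case: (entriesM u v). Qed.
Lemma ebM u v : eb (u * v)%g = ea u * eb v + eb u * ed v.
Proof. by case: (entriesM u v). Qed.
Lemma ecM u v : ec (u * v)%g = ec u * ea v + ed u * ec v.
Proof. by case: (entriesM u v). Qed.
Lemma edM u v : ed (u * v)%g = ec u * eb v + ed u * ed v.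
Proof. by case: (entriesM u v). Qed.

Lemma det_GLE u : \det (GLval u) = ea u * ed u - eb u * ec u.
Proof. exact: det2E. Qed.

Lemma inSL2_det u : (u \in G) = (\det (GLval u) == 1).
Proof. exact: in_set. Qed.

Lemma inSL2E u : (u \in G) = (ea u * ed u - eb u * ec u == 1).
Proof. by rewrite inSL2_det det_GLE. Qed.

Lemma inSL2P u : u \in G -> ea u * ed u = 1 + eb u * ec u.
Proof. by rewrite inSL2E subr_eq => /eqP. Qed.

Lemma ea1 : ea 1%g = 1. Proof. by rewrite /ea GLval1 mxE. Qed.
Lemma eb1 : eb 1%g = 0. Proof. by rewrite /eb GLval1 mxE. Qed.
Lemma ec1 : ec 1%g = 0. Proof. by rewrite /ec GLval1 mxE. Qed.
Lemma ed1 : ed 1%g = 1. Proof. by rewrite /ed GLval1 mxE. Qed.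
Definition entries1 := (ea1, eb1, ec1, ed1).

Lemma entries_mx2 (a b c d : F) : a * d - b * c != 0 ->
  exists u, [/\ ea u = a, eb u = b, ec u = c & ed u = d].
Proof.
move=> nz; have Mu : mx2 a b c d \is a GRing.unit.
  by rewrite -[_ \is a _]/(_ \in unitmx) unitmxE det2E !mxE /= unitfE.
by exists (FinRing.unit _ Mu : GL2 F); rewrite /ea /eb /ec /ed /= !mxE.
Qed.

Lemma SL2_ex (a b c d : F) : a * d - b * c = 1 ->
  exists2 u, u \in G & [/\ ea u = a, eb u = b, ec u = c & ed u = d].
Proof.
move=> e1; have [|u eu] := @entries_mx2 a b c d; first by rewrite e1 oner_neq0.
by exists u => //; rewrite inSL2E; case: eu => -> -> -> ->; rewrite e1.
Qed.

Lemma entriesV u : u \in G ->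
  [/\ ea u^-1%g = ed u, eb u^-1%g = - eb u, ec u^-1%g = - ec u & ed u^-1%g = ea u].
Proof.
move=> Gu; have := inSL2P Gu => e.
have [|w Gw [wa wb wc wd]] := @SL2_ex (ed u) (- eb u) (- ec u) (ea u).
  by ring: e.
suff -> : u^-1%g = w by split.
apply/eqP; rewrite eq_sym -(inj_eq (mulgI u)) mulgV; apply/eqP.
by apply: GL2P; rewrite ?eaM ?ebM ?ecM ?edM ?entries1 ?wa ?wb ?wc ?wd; ring: e.
Qed.

Lemma eaV u : u \in G -> ea u^-1%g = ed u. Proof. by case/entriesV. Qed.
Lemma ecV u : u \in G -> ec u^-1%g = - ec u. Proof. by case/entriesV. Qed.
Lemma edV u : u \in G -> ed u^-1%g = ea u. Proof. by case/entriesV. Qed.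

Lemma tr2V u : u \in G -> tr2 u^-1%g = tr2 u.
Proof. by move=> Gu; rewrite /tr2 eaV // edV // addrC. Qed.

Lemma tr2C u v : tr2 (u * v)%g = tr2 (v * u)%g.
Proof. by rewrite /tr2 !eaM !edM; ring. Qed.

Lemma tr2J u v : tr2 (u ^ v)%g = tr2 u.
Proof. by rewrite conjgE tr2C mulgK. Qed.

(* Inside [SL2 F] this means [u = 1] or [u = -1]. *)
Definition scal u := [&& eb u == 0, ec u == 0 & ea u == ed u].

(** The entries of u v - v u are, up to sign, the coordinates of the cross product of the vectors
    (b, c, a - d) of [u] and [v]: commuting is proportionality of these vectors, in every
    characteristic. *)
Lemma commuteE u v : reflect
  [/\ eb u * ec v = ec u * eb v, (ea u - ed u) * eb v = eb u * (ea v - ed v)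
    & (ea u - ed u) * ec v = ec u * (ea v - ed v)]
  (u * v == v * u)%g.
Proof.
apply: (iffP eqP) => [e|[h1 h2 h3]].
  have := congr1 ea e; have := congr1 eb e; have := congr1 ec e.
  rewrite !eaM !ebM !ecM => hc hb ha.
  split; apply/eqP; rewrite -subr_eq0; apply/eqP.
  - by transitivity (ea u * ea v + eb u * ec v - (ea v * ea u + eb v * ec u));
      [ring | rewrite ha subrr].
  - by transitivity (ea u * eb v + eb u * ed v - (ea v * eb u + eb v * ed u));
      [ring | rewrite hb subrr].
  - by transitivity (- (ec u * ea v + ed u * ec v - (ec v * ea u + ed v * ec u)));
      [ring | rewrite hc subrr oppr0].
apply: GL2P; rewrite ?eaM ?ebM ?ecM ?edM; apply/eqP; rewrite -subr_eq0; apply/eqP.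
- by transitivity (eb u * ec v - ec u * eb v); [ring | rewrite h1 subrr].
- by transitivity ((ea u - ed u) * eb v - eb u * (ea v - ed v)); [ring | rewrite h2 subrr].
- by transitivity (- ((ea u - ed u) * ec v - ec u * (ea v - ed v))); [ring | rewrite h3 subrr oppr0].
- by transitivity (- (eb u * ec v - ec u * eb v)); [ring | rewrite h1 subrr oppr0].
Qed.

Lemma scal_commute u v : scal u -> (u * v = v * u)%g.
Proof.
by case/and3P => /eqP b0 /eqP c0 /eqP ad; apply/eqP/commuteE; rewrite b0 c0 ad; split; ring.
Qed.

(** Two vectors parallel to a nonzero vector z are parallel to each other: each equality may be
    tested after multiplication by [z1], [z2] and [z3], where it is a combination of the
    hypotheses. *)
Lemma cross_trans (x1 x2 x3 y1 y2 y3 z1 z2 z3 : F) :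
    ~~ [&& z1 == 0, z2 == 0 & z3 == 0] ->
    x1 * z2 = x2 * z1 -> x1 * z3 = x3 * z1 -> x2 * z3 = x3 * z2 ->
    y1 * z2 = y2 * z1 -> y1 * z3 = y3 * z1 -> y2 * z3 = y3 * z2 ->
  [/\ x1 * y2 = x2 * y1, x1 * y3 = x3 * y1 & x2 * y3 = x3 * y2].
Proof.
move=> nz h1 h2 h3 k1 k2 k3.
have key (x y : F) : z1 * x = z1 * y -> z2 * x = z2 * y -> z3 * x = z3 * y -> x = y.
  move=> e1 e2 e3; apply: contraNeq nz; rewrite -subr_eq0 => nxy.
  have K z : z * x = z * y -> z == 0.
    by move/eqP; rewrite -subr_eq0 -mulrBr mulf_eq0 (negPf nxy) orbF.
  by rewrite (K _ e1) (K _ e2) (K _ e3).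
split; apply: key; apply/eqP; rewrite -subr_eq0; apply/eqP;
  move: h1 h2 h3 k1 k2 k3 => /eqP + /eqP + /eqP + /eqP + /eqP + /eqP;
  rewrite -!(subr_eq0 (_ * _)) => /eqP h1 /eqP h2 /eqP h3 /eqP k1 /eqP k2 /eqP k3.
- transitivity (y1 * (x1 * z2 - x2 * z1) - x1 * (y1 * z2 - y2 * z1)); last by rewrite h1 k1; ring.
  by ring.
- transitivity (y2 * (x1 * z2 - x2 * z1) - x2 * (y1 * z2 - y2 * z1)); last by rewrite h1 k1; ring.
  by ring.
- transitivity (y2 * (x1 * z3 - x3 * z1) - y1 * (x2 * z3 - x3 * z2) + x3 * (y2 * z1 - y1 * z2)); last first.
    by rewrite h2 h3 -(opprB (y1 * z2)) k1; ring.
  by ring.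
- transitivity (y1 * (x1 * z3 - x3 * z1) - x1 * (y1 * z3 - y3 * z1)); last by rewrite h2 k2; ring.
  by ring.
- transitivity (y3 * (x1 * z2 - x2 * z1) + y1 * (x2 * z3 - x3 * z2) - x2 * (y1 * z3 - y3 * z1)); last first.
    by rewrite h1 h3 k2; ring.
  by ring.
- transitivity (y3 * (x1 * z3 - x3 * z1) - x3 * (y1 * z3 - y3 * z1)); last by rewrite h2 k2; ring.
  by ring.
- transitivity (y1 * (x2 * z3 - x3 * z2) - x2 * (y1 * z3 - y3 * z1) + x3 * (y1 * z2 - y2 * z1)); last first.
    by rewrite h3 k1 k2; ring.
  by ring.
- transitivity (y2 * (x2 * z3 - x3 * z2) - x2 * (y2 * z3 - y3 * z2)); last by rewrite h3 k3; ring.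
  by ring.
- transitivity (y3 * (x2 * z3 - x3 * z2) - x3 * (y2 * z3 - y3 * z2)); last by rewrite h3 k3; ring.
  by ring.
Qed.

Lemma commute_trans z u v : ~~ scal z ->
  (u * z = z * u)%g -> (v * z = z * v)%g -> (u * v = v * u)%g.
Proof.
rewrite /scal -(subr_eq0 (ea z)) => nz.
move=> /eqP/commuteE[p1 p2 p3] /eqP/commuteE[r1 r2 r3]; apply/eqP/commuteE.
by have [] := cross_trans nz p1 (esym p2) (esym p3) r1 (esym r2) (esym r3).
Qed.

Lemma scalM1 z : z \in G -> scal z -> ea z ^+ 2 = 1.
Proof.
move=> /inSL2P + /and3P[/eqP b0 /eqP c0 /eqP e]; rewrite b0 -e mul0r addr0 => <-.
by rewrite expr2.
Qed.

Lemma scal_ext z w : scal z -> scal w -> ea z = ea w -> z = w.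
Proof.
move=> /and3P[/eqP b0 /eqP c0 /eqP e] /and3P[/eqP b0' /eqP c0' /eqP e'] h.
by apply: GL2P; rewrite ?b0 ?c0 -?e -?e'.
Qed.

Lemma card_quadratic (b c : F) : (#|[set x : F | (x ^+ 2 + b * x + c == 0)%R]| <= 2)%N.
Proof.
case: (pickP [pred x : F | x ^+ 2 + b * x + c == 0]) => [x0 /= /eqP hx0|h0]; last first.
  by rewrite eq_card0 // => x; rewrite !inE; apply: h0.
apply: (@leq_trans #|[set x0; - b - x0]|); last by rewrite cards2; case: eqP.
apply/subset_leq_card/subsetP=> x; rewrite !inE => /eqP hx.
rewrite -subr_eq0 -[x == _ - _]subr_eq0 -mulf_eq0; apply/eqP.
transitivity ((x ^+ 2 + b * x + c) - (x0 ^+ 2 + b * x0 + c)); first by ring.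
by rewrite hx hx0 subrr.
Qed.

Lemma card_scal : (#|[set z in G | scal z]| <= 2)%N.
Proof.
have inj : {in [set z in G | scal z] &, injective ea}.
  by move=> z w; rewrite ![_ \in [set _ in _ | _]]inE => /andP[_ sz] /andP[_ sw]; apply: scal_ext.
rewrite -(card_in_imset inj); apply: leq_trans (subset_leq_card _) (card_quadratic 0 (-1)).
apply/subsetP=> _ /imsetP[z zP ->]; move: zP; rewrite [_ \in [set _ in _ | _]]inE => /andP[Gz sz].
by rewrite inE (scalM1 Gz sz) mul0r addr0 subrr.
Qed.

Lemma scalJ u v : scal (u ^ v)%g = scal u.
Proof.
have H w x : scal w -> scal (w ^ x)%g.
  by move=> sw; rewrite /conjg (scal_commute x sw) mulKg.
by apply/idP/idP=> [/(H _ v^-1%g)|/H->//]; rewrite conjgK.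
Qed.

(** If [y] commuted with all its conjugates, those by upper unipotents [1, s; 0, 1] would force
    [ec y = 0] or [ea y - ed y = s * ec y] for every nonzero s. Two such s, available as q > 2,
    leave [ec y = 0]; then s = 1 gives [ea y = ed y], and a lower unipotent kills [eb y]. Elements
    of order 3 in SL_2(F_2) show that q = 2 is a genuine exception. *)
Lemma exists_noncommuting_conj y :
  (2 < #|F|)%N -> y \in G -> ~~ scal y ->
  exists2 g, g \in G & (y ^ g * y != y * y ^ g)%g.
Proof.
move=> q2 Gy nsy.
have [t t0 t1] : exists2 t : F, t != 0 & t != 1.
  have /card_gt0P[t] : (0 < #|[set~ (0%R : F)] :\ (1%R : F)|)%N.
    have := cardsD1 (1%R : F) [set~ (0%R : F)]; rewrite cardsC1 in_setC1 oner_neq0 /=; move: q2; case: #|F| => [|[|[|n]]] //= _; lia.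
  by rewrite !inE => /andP[? ?]; exists t.
pose P g := (y ^ g * y != y * y ^ g)%g.
case: (pickP [pred g in G | P g]) => [g /andP[]|all]; first by exists g.
have {}all g : g \in G -> (y ^ g * y == y * y ^ g)%g.
  by move=> Gg; have := all g; rewrite /= Gg /= => /negbFE.
exfalso.
have conjE g : g \in G ->
  [/\ ea (y ^ g)%g = ed g * (ea y * ea g + eb y * ec g) - eb g * (ec y * ea g + ed y * ec g),
      eb (y ^ g)%g = ed g * (ea y * eb g + eb y * ed g) - eb g * (ec y * eb g + ed y * ed g),
      ec (y ^ g)%g = - ec g * (ea y * ea g + eb y * ec g) + ea g * (ec y * ea g + ed y * ec g)
    & ed (y ^ g)%g = - ec g * (ea y * eb g + eb y * ed g) + ea g * (ec y * eb g + ed y * ed g)].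
  move=> Gg; rewrite conjgE; case: (entriesV Gg) => va vb vc vd.
  by rewrite !(eaM, ebM, ecM, edM) va vb vc vd; split; ring.
have up s : (ea y - ed y - s * ec y) * s * ec y = 0 /\
            (ea y - ed y) ^+ 2 * s = (ec y * s) * ((ea y - ed y) * s - 2 * eb y).
  have [|g Gg [ga gb gc gd]] := @SL2_ex 1 s 0 1; first by ring.
  have /commuteE[h1 h2 _] := all g Gg; have [] := conjE g Gg.
  rewrite ga gb gc gd => ya yb yc yd; move: h1 h2; rewrite ya yb yc yd.
  move=> /eqP; rewrite -subr_eq0 => /eqP h1 /eqP; rewrite -subr_eq0 => /eqP h2.
  split; first by rewrite -h1; ring.
  by apply/eqP; rewrite -subr_eq0 -oppr_eq0 -h2; apply/eqP; ring.
have [c0|c0] := eqVneq (ec y) 0; last first.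
  have e s : s != 0 -> ea y - ed y = s * ec y.
    move=> s0; have [/eqP + _] := up s; rewrite !mulf_eq0 (negPf s0) (negPf c0) !orbF.
    by rewrite subr_eq0 => /eqP.
  have := e t t0; rewrite (e 1 (oner_neq0 _)) => /(mulIf c0) /eqP.
  by rewrite eq_sym (negPf t1).
have /eqP e0 : ea y - ed y == 0.
  have [_] := up 1; rewrite c0 !mul0r mulr1 => /eqP.
  by rewrite expf_eq0.
have b0 : eb y != 0.
  by apply: contraNneq nsy => b0; rewrite /scal b0 c0 !eqxx -subr_eq0 e0 eqxx.
have [|g Gg [ga gb gc gd]] := @SL2_ex 1 0 1 1; first by ring.
have /commuteE[h1 _ _] := all g Gg; have [] := conjE g Gg.
rewrite ga gb gc gd => ya yb yc yd; move/eqP: h1; rewrite yb yc c0.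
rewrite -subr_eq0 => /eqP h1; have : eb y ^+ 2 = 0.
  by rewrite -h1 -[ed y](subrK (ea y)) -(opprB (ea y)) e0; ring.
by move/eqP; rewrite expf_eq0 (negPf b0).
Qed.
End Entries.

(** * Counting and product sets *)

Section Counting.

Lemma card_le_fibres (aT rT : finType) (f : aT -> rT) (D : {set aT}) (E : {set rT}) k :
  {in D, forall x, f x \in E} ->
  (forall y, y \in E -> #|[set x in D | f x == y]| <= k) -> #|D| <= k * #|E|.
Proof.
move=> fDE fib; rewrite -sum1_card (partition_big f (mem E)) //=.
rewrite mulnC -sum_nat_const; apply: leq_sum => y Ey.
by apply: leq_trans (fib y Ey); rewrite -sum1_card; under [X in _ <= X]eq_bigl do rewrite inE.
Qed.

Lemma sqr_sum_le (T : finType) (D : {set T}) (f : T -> nat) :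
  (\sum_(x in D) f x) ^ 2 <= #|D| * \sum_(x in D) f x ^ 2.
Proof.
rewrite -(leq_pmul2l (isT : 0 < 2)) -mulnn big_distrlr /= mulnA -mulnA.
have -> : 2 * (#|D| * \sum_(x in D) f x ^ 2)
        = \sum_(x in D) \sum_(y in D) (f x ^ 2 + f y ^ 2).
  under [RHS]eq_bigr => x _ do rewrite big_split /= sum_nat_const.
  by rewrite big_split /= sum_nat_const -big_distrr /= mul2n addnn.
rewrite big_distrr leq_sum // => x _; rewrite big_distrr leq_sum // => y _.
exact: nat_Cauchy.
Qed.

Lemma sum_card_fibres (aT rT : finType) (f : aT -> rT) (D : {set aT}) (E : {set rT}) :
  {in D, forall x, f x \in E} -> #|D| = \sum_(y in E) #|[set x in D | f x == y]|.
Proof.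
move=> fDE; rewrite -sum1_card (partition_big f (mem E)) //=.
by apply: eq_bigr => y Ey; rewrite -sum1_card; apply: eq_bigl => x; rewrite inE.
Qed.

Lemma sum_sqr_fibres (aT rT : finType) (f : aT -> rT) (D : {set aT}) (E : {set rT}) :
  {in D, forall x, f x \in E} ->
  \sum_(y in E) #|[set x in D | f x == y]| ^ 2 =
  #|[set p in setX D D | f p.1 == f p.2]|.
Proof.
move=> fDE; rewrite (@sum_card_fibres _ _ (fun p => f p.1) _ E); last first.
  by move=> p; rewrite !inE => /andP[/andP[/fDE]].
apply: eq_bigr => y Ey; rewrite -mulnn -cardsX; apply: eq_card => -[u v].
rewrite !inE /=; case: eqP => [->|]; rewrite ?andbT ?andbF // eq_sym.
by rewrite -!andbA.
Qed.

Lemma collision_bound (aT rT : finType) (f : aT -> rT) (D : {set aT}) (E : {set rT}) :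
  {in D, forall x, f x \in E} ->
  #|D| ^ 2 <= #|E| * #|[set p in setX D D | f p.1 == f p.2]|.
Proof.
move=> fDE; rewrite -(sum_sqr_fibres fDE) {1}(sum_card_fibres fDE).
exact: sqr_sum_le.
Qed.

Lemma exists_large_fibre (aT rT : finType) (f : aT -> rT) (D : {set aT}) (E : {set rT}) :
  {in D, forall x, f x \in E} -> 0 < #|D| ->
  exists2 y, y \in E & #|D| <= #|[set x in D | f x == y]| * #|E|.
Proof.
move=> fDE D0; case: (pickP [pred y | (y \in E) &&
   (#|D| <= #|[set x in D | f x == y]| * #|E|)]) => [y /andP[]|none]; first by exists y.
have E0 : 0 < #|E|.
  by case/card_gt0P: D0 => x /fDE Ex; apply/card_gt0P; exists (f x).
suff : #|D| * #|E| < #|D| * #|E| by rewrite ltnn.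
rewrite {1}(sum_card_fibres fDE) big_distrl /= mulnC -sum_nat_const.
apply: (@leq_ltn_trans (\sum_(y in E) #|D|.-1)).
  apply: leq_sum => y Ey; have := none y; rewrite /= Ey /= => /negbT.
  by rewrite -ltnNge; case: #|D| D0.
by rewrite !sum_nat_const ltn_pmul2l // prednK.
Qed.

Lemma torus_count_arith q c r n m :
  q ^ 2 <= 4 * c -> 4 < r -> c * (r - 2) <= 2 * n -> n <= m -> q ^ 2 * r <= 16 * m.
Proof.
move=> hc hr hn nm; have hr2 : r <= 2 * (r - 2) by lia.
by have := leq_mul hc hr2; rewrite mulnACA; lia.
Qed.

End Counting.

Section SetPowers.
Variable gT : finGroupType.
Implicit Types A B X Y Z : {set gT}.
Local Open Scope group_scope.

Lemma mem_expgs1 A n : 1 \in A -> 1 \in A ^+ n.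
Proof.
move=> A1; elim: n => [|n IHn]; first by rewrite expg0 set11.
by rewrite expgS -[1]mulg1 mem_mulg.
Qed.

Lemma expgsD A m n x y : x \in A ^+ m -> y \in A ^+ n -> x * y \in A ^+ (m + n).
Proof. by move=> Ax Ay; rewrite expgD mem_mulg. Qed.

Lemma expgs_subset A m n : 1 \in A -> (m <= n)%N -> A ^+ m \subset A ^+ n.
Proof.
move=> A1 le_mn; apply/subsetP => x Ax; rewrite -(subnKC le_mn) -[x]mulg1.
by rewrite expgsD ?mem_expgs1.
Qed.

Lemma subset_expgs A n : 1 \in A -> (0 < n)%N -> A \subset A ^+ n.
Proof. by move=> A1 n0; rewrite -{1}[A]expg1 expgs_subset. Qed.

Lemma expgsV A n : A^-1 = A -> (A ^+ n)^-1 = A ^+ n.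
Proof.
move=> sA; elim: n => [|n IHn]; first by rewrite !expg0 invg_set1 invg1.
by rewrite expgSr invMg IHn sA -expgS expgSr.
Qed.

Lemma expgs_sub_group A (G : {group gT}) n : A \subset G -> A ^+ n \subset G.
Proof.
move=> sAG; elim: n => [|n IHn]; first by rewrite expg0 sub1set.
by rewrite expgS mul_subG.
Qed.

Lemma gen_expgs_eq A n : 1 \in A -> (0 < n)%N -> <<A ^+ n>> = <<A>>.
Proof.
move=> A1 n0; apply/eqP; rewrite eqEsubset !gen_subG.
by rewrite expgs_sub_group ?subset_gen // (subset_trans (subset_expgs A1 n0)) ?subset_gen.
Qed.

Lemma expgs_mono A B n : A \subset B -> A ^+ n \subset B ^+ n.
Proof.
move=> sAB; elim: n => [|n IHn]; first by rewrite !expg0.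
by rewrite !expgS mulgSS.
Qed.

(** Fix one factorisation w = x z for each w in X Z. The map (w, y) |-> (x y^-1, y z) is injective:
    the product of the two components is w, which determines x and z, hence y. *)
Lemma ruzsa_triangle X Y Z : (#|(X * Z)%g| * #|Y| <= #|(X * Y^-1)%g| * #|(Y * Z)%g|)%N.
Proof.
have split_ex w : w \in X * Z -> exists p, (p \in setX X Z) && (w == p.1 * p.2).
  by case/mulsgP => x z Xx Zz ->; exists (x, z); rewrite inE /= Xx Zz eqxx.
pose s w := if [pick p | (p \in setX X Z) && (w == p.1 * p.2)] is Some p then p else (1, 1).
have sP w : w \in X * Z -> [/\ (s w).1 \in X, (s w).2 \in Z & w = (s w).1 * (s w).2].
  move=> /split_ex[p hp]; rewrite /s; case: pickP => [r|/(_ p)]; last by rewrite hp.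
  by rewrite inE -andbA => /and3P[? ? /eqP].
pose f (p : gT * gT) := ((s p.1).1 * p.2^-1, p.2 * (s p.1).2).
have f_inj : {in setX (X * Z) Y &, injective f}.
  move=> [w y] [w' y']; move=> /setXP[/= XZw Yy] /setXP[/= XZw' Yy'] [/= e1 e2].
  have ew : w = w'.
    have [_ _ hw] := sP w XZw; have [_ _ hw'] := sP w' XZw'.
    by rewrite hw [RHS]hw' -(mulgKV y (s w).1) -mulgA e1 e2 mulgA mulgKV.
  by rewrite ew in e2 *; rewrite (mulIg _ _ _ e2).
rewrite -!cardsX -(card_in_imset f_inj); apply/subset_leq_card/subsetP => _ /imsetP[[w y]] /setXP[/sP[Xs Zs _] Yy] ->.
by rewrite inE /= !mem_mulg // memV_invg.
Qed.

End SetPowers.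

(** * Growth of symmetric generating sets *)

Section Commutation.
Variable gT : finGroupType.
Implicit Types s t u v x : gT.
Local Open Scope group_scope.

Definition commutes u v := u * v == v * u.

Lemma commutesC u v : commutes u v = commutes v u.
Proof. by rewrite /commutes eq_sym. Qed.

Lemma mem_cent1 u v : (u \in 'C[v]) = commutes u v.
Proof. by apply/cent1P/eqP=> /esym. Qed.

Lemma commutesJ u v x : commutes (u ^ x) (v ^ x) = commutes u v.
Proof. by rewrite /commutes -!conjMg (inj_eq (conjg_inj x)). Qed.

Lemma commutesJV u v x : commutes u (v ^ x^-1) = commutes (u ^ x) v.
Proof. by rewrite -{1}[u](conjgK x) commutesJ. Qed.

Lemma commutesMl u v : commutes u v -> commutes (u^-1 * v) u.
Proof.
by move=> c; rewrite -mem_cent1 groupM ?groupV ?cent1id // mem_cent1 commutesC.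
Qed.

Lemma sandwich_conj s t s0 t0 x :
  s * x^-1 * t = s0 * x^-1 * t0 -> s0^-1 * s = (t0 * t^-1) ^ x.
Proof.
move=> e; have -> : s = s0 * x^-1 * t0 * t^-1 * x by rewrite -e mulgK mulgKV.
by rewrite conjgE !mulgA mulVg mul1g.
Qed.

Lemma sandwich_central s t s0 t0 x : s * x^-1 * t = s0 * x^-1 * t0 ->
  s0^-1 * s * x^-1 = x^-1 * (s0^-1 * s) -> t = (s0^-1 * s)^-1 * t0.
Proof.
move=> e; set z := s0^-1 * s => c; have es : s = s0 * z by rewrite mulKVg.
clearbody z; apply: (mulgI (s * x^-1)); rewrite e es -!mulgA; congr (_ * _).
by rewrite (mulgA z) c -mulgA mulKVg.
Qed.

End Commutation.

(* The features of SL_2(F) on which the growth argument rests, with [tr] the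
   trace, [reg] excluding the traces 2 and -2, and [sing u v] meaning that [u]
   and [v] share an eigenvector over the algebraic closure. *)
Section Growth.
Variables (gT : finGroupType) (G : {group gT}) (T : finType) (tr : gT -> T).
Variables (scal : pred gT) (sing : rel gT) (reg : pred T).
Implicit Types (A : {set gT}) (g h u v x y z : gT).
Local Open Scope group_scope.

Hypothesis scal_commutes : forall z u, scal z -> commutes z u.
Hypothesis scalJ : forall z u, scal (z ^ u) = scal z.
Hypothesis card_scal : #|[set z in G | scal z]| <= 2.
Hypothesis commutes_trans : forall z u v,
  ~~ scal z -> commutes u z -> commutes v z -> commutes u v.
Hypothesis noncommuting_conj : forall y, y \in G -> ~~ scal y ->
  exists2 g, g \in G & ~~ commutes (y ^ g) y.
Hypothesis commutes_sing : forall u v, commutes u v -> sing u v.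
Hypothesis singMr : forall u v, sing u (u * v) = sing u v.
Hypothesis sing_cover : forall x, x \in G -> reg (tr x) ->
  exists u v, [/\ u \in G, v \in G, ~~ scal u, ~~ scal v &
    forall g, g \in G -> tr g = tr x -> sing x g ->
      [|| commutes (x^-1 * g) u, commutes (x * g) u,
          commutes (x^-1 * g) v | commutes (x * g) v]].
Hypothesis trace_fibre : forall h z t, h \in G -> z \in G -> ~~ commutes h z ->
  #|[set x in G | [&& tr x == t, tr (x^-1 * h) == t, tr (x^-1 * z) == t &
                      ~~ sing x h]]| <= 2.

(** The [x] for which [y ^ x] commutes with [y] form a group, by transitivity of commuting; if it
    contained [A] it would be all of [G]. *)
Lemma generator_noncommuting A y :
  1 \in A -> <<A>> = G -> y \in G -> ~~ scal y ->
  exists2 x, x \in A & ~~ commutes (y ^ x) y.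
Proof.
move=> A1 genA Gy nsy.
case: (pickP [pred x in A | ~~ commutes (y ^ x) y]) => [x /andP[]|all]; first by exists x.
have {}all x : x \in A -> commutes (y ^ x) y.
  by move=> Ax; have := all x; rewrite /= Ax /= => /negbFE.
pose H := [set x | commutes (y ^ x) y].
have gH : group_set H.
  apply/group_setP; split=> [|g h]; first by rewrite in_set conjg1 /commutes.
  rewrite !in_set => Hg Hh; apply: (@commutes_trans (y ^ h)); first by rewrite scalJ.
    by rewrite conjgM commutesJ.
  by rewrite commutesC.
have : G \subset Group gH.
  by rewrite -genA gen_subG; apply/subsetP=> x /all cx; rewrite in_set.
have [g Gg /negbTE ncg] := noncommuting_conj Gy nsy.
by move/subsetP/(_ g Gg); rewrite in_set ncg.
Qed.

(* Some conjugate of the centraliser by an element of [A] meets it only in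
   scalars, so [(s, t) |-> s * x^-1 * t] has fibres of size at most 2. *)
Lemma centraliser_bound A y :
  A^-1 = A -> 1 \in A -> <<A>> = G -> y \in G -> ~~ scal y ->
  #|A ^+ 2 :&: 'C[y]| ^ 2 <= 2 * #|A ^+ 5|.
Proof.
move=> sA A1 genA Gy nsy.
have [x Ax ncx] := generator_noncommuting A1 genA Gy nsy.
have sAG : A \subset G by rewrite -genA subset_gen.
set D := A ^+ 2 :&: _; rewrite -mulnn -cardsX.
have DG s : s \in D -> s \in G.
  by case/setIP=> /(subsetP (expgs_sub_group 2 sAG)).
apply: (@card_le_fibres _ _ (fun p => p.1 * x^-1 * p.2)).
  move=> [s t] /setXP[/= /setIP[s2 _] /setIP[t2 _]].
  apply: (@expgsD _ _ 3 2) => //; apply: (@expgsD _ _ 2 1) => //.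
  by rewrite expg1 -sA memV_invg.
move=> w _; set E := finset _.
case: (pickP (mem E)) => [[s0 t0]|E0]; last by rewrite eq_card0.
rewrite /= in_set => /andP[/setXP[/= Ds0 Dt0] /eqP e0].
apply: leq_trans card_scal.
apply: (@leq_trans #|[set (s0 * z, z^-1 * t0) | z in [set z in G | scal z]]|);
  last exact: leq_imset_card.
apply/subset_leq_card/subsetP => -[s t]; rewrite in_set => /andP[/setXP[/= Ds Dt] /eqP e].
have eqz : s0^-1 * s = (t0 * t^-1) ^ x by apply: sandwich_conj; rewrite e e0.
have [/setIP[_ cs0] /setIP[_ ct0] /setIP[_ cs] /setIP[_ ct]] := And4 Ds0 Dt0 Ds Dt.
have sz : scal (s0^-1 * s).
  apply: contraR ncx => nsz; apply/(commutes_trans nsz).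
    by rewrite eqz commutesC commutesJ -mem_cent1 groupM ?groupV.
  by rewrite commutesC -mem_cent1 groupM ?groupV.
apply/imsetP; exists (s0^-1 * s); first by rewrite in_set sz groupM ?groupV ?DG.
rewrite mulKVg; congr (_, _); apply: (@sandwich_central _ _ _ _ _ x).
  by rewrite e e0.
exact/eqP/scal_commutes.
Qed.

Definition max_cent A := \max_(y in G | ~~ scal y) #|A ^+ 2 :&: 'C[y]|.

Lemma max_cent_bound A : A^-1 = A -> 1 \in A -> <<A>> = G ->
  max_cent A ^ 2 <= 2 * #|A ^+ 5|.
Proof.
move=> sA A1 genA; rewrite /max_cent.
elim/big_ind: _ => [//|m n hm hn|y /andP[Gy nsy]]; last exact: centraliser_bound.
by rewrite /maxn; case: ifP.
Qed.

(** Left division by one member of the set moves all of it into [A ^+ 2 :&: 'C[u]]. *)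
Lemma coset_cent_bound A (c u : gT) : A^-1 = A -> u \in G -> ~~ scal u ->
  #|[set g in A | commutes (c * g) u]| <= max_cent A.
Proof.
move=> sA Gu nsu; set S := finset _.
case: (pickP (mem S)) => [g0|S0]; last by rewrite eq_card0.
rewrite /= in_set => /andP[Ag0 cg0].
rewrite -(card_imset S (mulgI g0^-1)).
have := @leq_bigmax_cond _ (fun y => (y \in G) && ~~ scal y)
  (fun y => #|A ^+ 2 :&: 'C[y]|) u.
rewrite Gu => /(_ nsu); apply: leq_trans.
apply/subset_leq_card/subsetP => _ /imsetP[g + ->].
rewrite in_set => /andP[Ag cg]; rewrite in_setI; apply/andP; split.
  by apply: (@expgsD _ _ 1 1); rewrite expg1 // -sA memV_invg.
have -> : g0^-1 * g = (c * g0)^-1 * (c * g) by rewrite invMg mulgA mulgKV.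
by rewrite groupM ?groupV // mem_cent1.
Qed.

(* The map [(x, g, g') |-> (x g, x g')] on triples of elements of trace [t]
   generically has fibres of size at most 2, since [x] then satisfies three
   independent linear equations and one quadratic one.  Here [h] is a popular
   value of [x g], chosen before [g'] varies. *)
Lemma class_bound A t : A^-1 = A -> 1 \in A -> <<A>> = G -> reg t ->
  #|[set x in A | tr x == t]| ^ 3 <= 2048 * #|A ^+ 5| ^ 2.
Proof.
move=> sA A1 genA rt; set B := finset _; set N := #|A ^+ 5|.
set M := max_cent A; have hM : M ^ 2 <= 2 * N := max_cent_bound sA A1 genA.
have sAG : A \subset G by rewrite -genA subset_gen.
have BP x : x \in B -> [/\ x \in A, x \in G & tr x = t].
  by rewrite in_set => /andP[Ax /eqP]; rewrite (subsetP sAG).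
have N0 : 0 < N by apply/card_gt0P; exists 1; apply: mem_expgs1.
(* Below [8 * M] the claim follows from [hM], with 2048 = 8^3 * 2^2. Above, the singular pairs, at
   most [4 * M] for each [x], are at most half of all pairs. *)
have [ltB|leB] := ltnP #|B| (8 * M).
  have e1 : #|B| ^ 3 <= (8 * M) ^ 3 by rewrite leq_exp2r // ltnW.
  have e2 : (8 * M) ^ 3 <= 512 * (M ^ 2 * M ^ 2).
    rewrite expnMn -expnD; apply: (@leq_mul (8 ^ 3) _ 512) => //.
    by case: (M) => // m; apply: leq_pexp2l.
  have e3 := leq_mul hM hM; lia.
set N2 := #|A ^+ 2|; have N25 : N2 <= N by apply/subset_leq_card/expgs_subset.
pose P := [set p in setX B B | ~~ sing p.1 p.2].
have cardP : #|B| ^ 2 <= 2 * #|P|.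
  suff : #|setX B B :\: P| <= 4 * M * #|B|.
    have := cardsID P (setX B B); rewrite cardsX (setIidPr _); last first.
      by apply/subsetP=> p; rewrite in_set => /andP[].
    by nia.
  apply: (@card_le_fibres _ _ fst).
    by move=> [x g] /setDP[/setXP[]].
  move=> x Bx; have [Ax Gx tx] := BP x Bx.
  have [|u [v [Gu Gv nsu nsv cov]]] := sing_cover Gx; first by rewrite tx.
  pose S c w := [set g in A | commutes (c * g) w].
  apply: (@leq_trans #|S x^-1 u :|: S x u :|: (S x^-1 v :|: S x v)|); last first.
    have cU (X Y : {set gT}) : #|X :|: Y| <= #|X| + #|Y| by rewrite cardsU leq_subr.
    have h w c : w \in G -> ~~ scal w -> #|S c w| <= M by apply: coset_cent_bound.
    rewrite (leq_trans (cU _ _)) // -[4]/(2 + 2) mulnDl leq_add //.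
      by rewrite (leq_trans (cU _ _)) // mul2n -addnn leq_add ?h.
    by rewrite (leq_trans (cU _ _)) // mul2n -addnn leq_add ?h.
  set L := finset _; have LE p : p \in L -> p.1 = x by rewrite in_set => /andP[_ /eqP].
  have inj : {in L &, injective (@snd gT gT)}.
    by move=> [a b] [a' b'] /LE /= -> /LE /= -> /= ->.
  rewrite -(card_in_imset inj); apply/subset_leq_card/subsetP => _ /imsetP[[x' g] + ->].
  rewrite [_ \in L]in_set => /andP[/setDP[/setXP[_ /= Bg] nP] /eqP /= ex]; subst x'.
  have [Ag Gg tg] := BP g Bg; move: nP; rewrite in_set in_setX Bx Bg /= negbK => sxg.
  rewrite !in_setU !in_set Ag /=; have := cov g Gg _ sxg; rewrite tx tg => /(_ erefl).
  by case/or4P=> ->; rewrite ?orbT.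
have [B0|B0] := posnP #|B|; first by rewrite B0.
have P0 : 0 < #|P| by nia.
have [|h h2 hh] := @exists_large_fibre _ _ (fun p => p.1 * p.2) P (A ^+ 2) _ P0.
  move=> [x g]; rewrite in_set => /andP[/setXP[/= /BP[Ax _ _] /BP[Ag _ _]] _].
  by rewrite expgS expg1 mem_mulg.
set Ph := finset _ in hh; pose X := [set p.1 | p in Ph].
have cardX : #|X| = #|Ph|.
  apply: card_in_imset => -[x g] [x' g']; rewrite !in_set => /andP[_ /eqP /= e].
  by move=> /andP[_ /eqP /= e'] /= ex; rewrite ex in e *; congr (_, _); apply: (mulgI x'); rewrite e.
have Gh : h \in G by apply: subsetP h2; apply: expgs_sub_group.
have XP x : x \in X -> [/\ x \in B, tr (x^-1 * h) = t & ~~ sing x h].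
  case/imsetP=> -[x' g]; rewrite in_set => /andP[+ /eqP /= eh] /= ->.
  rewrite in_set => /andP[/setXP[/= Bx Bg] nsing]; rewrite -eh mulKg singMr; split=> //.
  by case/BP: Bg.
have nsh : ~~ scal h.
  have : 0 < #|X|.
    by rewrite cardX lt0n; apply: contraTneq hh => ->; rewrite mul0n -ltnNge.
  case/card_gt0P=> x /XP[_ _]; apply: contra => /scal_commutes sh.
  by apply: commutes_sing; rewrite commutesC.
(* For each [x] at most [M] elements [g] make [x * g] commute with [h]; discarding them keeps the
   linear equations of [trace_fibre] independent. *)
pose Q := [set p in setX X B | ~~ commutes (p.1 * p.2) h].
have cardQ : #|X| * #|B| <= 2 * #|Q|.
  suff : #|setX X B :\: Q| <= M * #|X|.
    have := cardsID Q (setX X B); rewrite cardsX (setIidPr _); last first.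
      by apply/subsetP=> p; rewrite in_set => /andP[].
    by nia.
  apply: (@card_le_fibres _ _ fst).
    by move=> [x g] /setDP[/setXP[]].
  move=> x Xx; apply: leq_trans (coset_cent_bound x sA Gh nsh).
  set L := finset _; have LE p : p \in L -> p.1 = x by rewrite in_set => /andP[_ /eqP].
  have inj : {in L &, injective (@snd gT gT)}.
    by move=> [a b] [a' b'] /LE /= -> /LE /= -> /= ->.
  rewrite -(card_in_imset inj); apply/subset_leq_card/subsetP => _ /imsetP[[x' g] + ->].
  rewrite [_ \in L]in_set => /andP[/setDP[/setXP[_ /= Bg] nQ] /eqP /= ex]; subst x'.
  move: nQ; rewrite in_set in_setX Xx Bg /= negbK => cxg.
  by rewrite in_set cxg; case/BP: Bg => ->.
have : #|Q| <= 2 * N2.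
  apply: (@card_le_fibres _ _ (fun p => p.1 * p.2)).
    move=> [x g]; rewrite in_set => /andP[/setXP[/= /XP[/BP[Ax _ _] _ _] /BP[Ag _ _]] _].
    by rewrite expgS expg1 mem_mulg.
  move=> z z2; have Gz : z \in G by apply: subsetP z2; apply: expgs_sub_group.
  set L := finset _.
  case: (boolP (commutes z h)) => [czh|nczh].
    rewrite (_ : L = set0) ?cards0 //; apply/setP=> -[x g]; rewrite [RHS]in_set in_set.
    by apply/negbTE/negP => /andP[+ /eqP /= e]; rewrite in_set /= e czh andbF.
  rewrite commutesC in nczh; apply: leq_trans (trace_fibre t Gh Gz nczh).
  have inj : {in L &, injective (@fst gT gT)}.
    move=> [x g] [x' g']; rewrite !in_set => /andP[_ /eqP /= e].
    by move=> /andP[_ /eqP /= e'] /= ex; rewrite ex in e *; congr (_, _); apply: (mulgI x'); rewrite e.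
  rewrite -(card_in_imset inj); apply/subset_leq_card/subsetP => _ /imsetP[[x g] + ->].
  rewrite in_set => /andP[+ /eqP /= e]; rewrite in_set => /andP[/setXP[/= Xx Bg] _].
  have [/BP[_ Gx tx] th nsing] := XP x Xx; have [_ _ tg] := BP g Bg.
  by rewrite in_set Gx tx th nsing -e mulKg tg !eqxx.
rewrite cardX in cardQ * => hQ.
have e1 : #|B| * #|B| ^ 2 <= #|B| * (2 * (#|Ph| * N2)).
  by rewrite leq_mul // (leq_trans cardP) // leq_mul.
have e2 : #|Ph| * #|B| * N2 <= 2 * (2 * N2) * N2.
  by rewrite leq_mul // (leq_trans cardQ) // leq_mul.
have e3 : N2 * N2 <= N * N by rewrite leq_mul.
by rewrite expnS -(mulnn N); lia.
Qed.

Hypothesis trJ : forall u x, tr (u ^ x) = tr u.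
Hypothesis reg_nonscal : forall u, u \in G -> reg (tr u) -> ~~ scal u.
Hypothesis escape : forall y z, y \in G -> z \in G -> ~~ commutes z y -> tr z = tr y ->
  [|| reg (tr y), reg (tr (z * y)) | reg (tr (z * y^-1))].
Hypothesis reg_cent : forall y z, y \in G -> z \in G -> reg (tr y) ->
  commutes z y -> ~~ scal z -> reg (tr z).
Hypothesis same_trace : forall y z, y \in G -> z \in G -> reg (tr y) ->
  commutes z y -> tr z = tr y -> (z == y) || (z == y^-1).
Variable q : nat.
Hypothesis card_T : #|T| <= q.
Hypothesis card_G : q ^ 3 <= 2 * #|G|.

Lemma card_same_trace (E : {set gT}) :
  {in E, forall x, x \in G} -> {in E &, forall x y, commutes x y /\ tr x = tr y} ->
  {in E, forall x, reg (tr x)} -> #|E| <= 2.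
Proof.
move=> EG cE regE; case: (pickP (mem E)) => [y Ey|E0]; last by rewrite eq_card0.
apply: (@leq_trans #|[set y; y^-1]|); last by rewrite cards2; case: eqP.
apply/subset_leq_card/subsetP => z Ez; rewrite in_set2.
by have [cz tz] := cE z y Ez Ey; apply: same_trace; rewrite ?EG ?regE.
Qed.

(** Each trace occurs at most twice in the centraliser of [g], so that centraliser has at most 2 q
    elements; [card_G] and Lagrange do the rest. *)
Lemma card_class g : g \in G -> reg (tr g) -> q ^ 2 <= 4 * #|g ^: G|.
Proof.
move=> Gg rg; have nsg := reg_nonscal Gg rg.
have [->//|q0] := posnP q.
have cC : #|'C_G[g]| <= 2 * q.
  apply: leq_trans (leq_mul (leqnn 2) card_T); rewrite -cardsT.
  apply: (@card_le_fibres _ _ tr) => // t _; set E := finset _.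
  have EP x : x \in E -> [/\ x \in G, commutes x g & tr x = t].
    by rewrite in_set => /andP[/setIP[Gx]]; rewrite mem_cent1 => cx /eqP.
  case: (pickP [pred x in E | ~~ scal x]) => [y /andP[/EP[Gy cy ty] nsy]|all].
    apply: card_same_trace => [x /EP[]//|x z /EP[_ cx tx] /EP[_ cz tz]|x /EP[_ _ ->]].
      by rewrite tx tz; split=> //; apply: commutes_trans nsg _ _.
    by rewrite -ty; apply: reg_cent cy nsy.
  apply: leq_trans card_scal; apply/subset_leq_card/subsetP => x Ex.
  have := all x; rewrite /= Ex /= => /negbFE sx.
  by rewrite in_set sx andbT; case/EP: Ex.
have := Lagrange (subsetIl G 'C[g]); rewrite index_cent1 => eG.
rewrite -(leq_pmul2l (_ : 0 < 2 * q)) ?muln_gt0 //.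
have := leq_mul cC (leqnn #|g ^: G|); rewrite eG => h.
by have := leq_trans card_G (leq_mul (leqnn 2) h); rewrite expnS; lia.
Qed.

(** A nonscalar generator has a conjugate by [A] that does not commute with it, and the two share
    their trace, so [escape] applies. The conjugate costs three letters, hence the exponent 4. *)
Lemma exists_reg A : A^-1 = A -> 1 \in A -> <<A>> = G ->
  (exists2 g, g \in G & ~~ scal g) -> exists2 g, g \in A ^+ 4 & reg (tr g).
Proof.
move=> sA A1 genA [g Gg nsg]; have sAG : A \subset G by rewrite -genA subset_gen.
have [x Ax nsx] : exists2 x, x \in A & ~~ scal x.
  case: (pickP [pred x in A | ~~ scal x]) => [x /andP[]|all]; first by exists x.
  have : A \subset 'C[g].
    apply/subsetP=> x Ax; rewrite mem_cent1 scal_commutes //.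
    by have := all x; rewrite /= Ax => /negbFE.
  rewrite -gen_subG genA => /subsetP cg.
  have [h Gh /negP[]] := noncommuting_conj Gg nsg.
  by rewrite -mem_cent1 cg // groupJ.
have Gx : x \in G by apply: subsetP Ax.
have [a Aa nc] := generator_noncommuting A1 genA Gx nsx.
have AV u : u \in A -> u^-1 \in A by move=> Au; rewrite -sA memV_invg.
have A3 : x ^ a \in A ^+ 3.
  rewrite conjgE; apply: (@expgsD _ _ 1 2); first by rewrite expg1 AV.
  by apply: (@expgsD _ _ 1 1); rewrite expg1.
have Ga : x ^ a \in G by rewrite groupJ //; apply: subsetP Aa.
case/or3P: (escape Gx Ga nc (trJ _ _)) => r.
- by exists x => //; apply: subsetP Ax; apply: subset_expgs.
- by exists (x ^ a * x) => //; apply: (@expgsD _ _ 3 1); rewrite // expg1.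
- by exists (x ^ a * x^-1) => //; apply: (@expgsD _ _ 3 1); rewrite // expg1 AV.
Qed.

(* Orbit-stabiliser: conjugating [g] by [A] stays in one conjugacy class. *)
Lemma torus_lower_bound A g : A^-1 = A -> 1 \in A -> <<A>> = G ->
  g \in A ^+ 4 -> reg (tr g) ->
  #|A| ^ 3 <= 2048 * #|A ^+ 30| ^ 2 * #|A ^+ 2 :&: 'C[g]| ^ 3.
Proof.
move=> sA A1 genA A4 rg.
have AV u : u \in A -> u^-1 \in A by move=> Au; rewrite -sA memV_invg.
(* The words [g ^ a] have length 1 + 4 + 1 = 6, and the fifth power of [A ^+ 6] is [A ^+ 30]. *)
have := @class_bound (A ^+ 6) (tr g) (expgsV 6 sA) (mem_expgs1 6 A1).
rewrite gen_expgs_eq // -expgM => /(_ genA rg).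
set B := finset _ => hB; apply: leq_trans (leq_mul hB (leqnn _)).
rewrite -expnMn leq_exp2r // mulnC; apply: (@card_le_fibres _ _ (fun a => g ^ a)).
  move=> a Aa; rewrite in_set trJ eqxx andbT conjgE.
  apply: (@expgsD _ _ 1 5); first by rewrite expg1 AV.
  by apply: (@expgsD _ _ 4 1); rewrite ?expg1.
move=> w _; set E := finset _; case: (pickP (mem E)) => [a0|E0]; last by rewrite eq_card0.
rewrite /= in_set => /andP[Aa0 /eqP e0].
rewrite -(card_imset _ (mulIg a0^-1)); apply/subset_leq_card/subsetP => _ /imsetP[a Ea ->].
move: Ea; rewrite [_ \in E]in_set => /andP[Aa /eqP e]; rewrite in_setI; apply/andP; split.
  by apply: (@expgsD _ _ 1 1); rewrite expg1 ?AV.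
by rewrite mem_cent1 /commutes eq_sym -(inj_eq (mulgI (a * a0^-1)^-1)) mulKg -conjgE
  conjgM e -e0 conjgK.
Qed.

Lemma symmetric_growth A : A^-1 = A -> 1 \in A -> <<A>> = G ->
  (exists2 g, g \in G & ~~ scal g) ->
  #|A| ^ 3 <= 2 ^ 18 * #|A ^+ 30| ^ 2 \/
  q ^ 6 * #|A| ^ 3 <= 2 ^ 23 * #|A ^+ 30| ^ 5.
Proof.
move=> sA A1 genA nsG; have sAG : A \subset G by rewrite -genA subset_gen.
have [g A4 rg] := exists_reg sA A1 genA nsG.
have Gg : g \in G by apply: subsetP A4; apply: expgs_sub_group.
set N := #|A ^+ 30|; have [?|big] := leqP (#|A| ^ 3) (2 ^ 18 * N ^ 2); [by left | right].
pose r y := #|A ^+ 2 :&: 'C[y]|.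
pose P y := #|A| ^ 3 <= 2048 * N ^ 2 * r y ^ 3.
(* With [r y <= 4], [P y] would give #|A|^3 <= 2^17 * N^2, against [big]. Having more than 4
   elements, the torus keeps at least half of them when its scalars, at most two, are discarded. *)
have P5 y : P y -> 4 < r y.
  rewrite /P ltnNge => h; apply/negP => r4; move: big; rewrite ltnNge => /negP[].
  have h4 : r y ^ 3 <= 4 ^ 3 by rewrite leq_exp2r.
  apply: leq_trans h _; apply: leq_trans (leq_mul (leqnn _) h4) _; lia.
(* A nonscalar [z] in [A ^+ 2 :&: 'C[y]] has the centraliser of [y]; its conjugate by [a] is a
   regular element of [A ^+ 4], to which [torus_lower_bound] applies directly. So [P] passes from
   [y] to [y ^ a] with no loss in the constant, and the induction along words of any length is
   free. *)
pose S := [set y in g ^: G | P y].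
have AN : A \subset 'N(S).
  apply/subsetP=> a Aa; rewrite in_set; apply/subsetP => _ /imsetP[y0 Sy ->].
  move: Sy; rewrite !in_set => /andP[/imsetP[x Gx ->] Py].
  have Ga := subsetP sAG a Aa; set y := g ^ x in Py *.
  have Gy : y \in G by rewrite groupJ.
  have ry : reg (tr y) by rewrite trJ.
  have nsg := reg_nonscal Gg rg.
  have [z /setIP[A2z]] : exists2 z, z \in A ^+ 2 :&: 'C[y] & ~~ scal z.
    case: (pickP [pred z in A ^+ 2 :&: 'C[y] | ~~ scal z]) => [z /andP[]|all]; first by exists z.
    have := P5 y Py; rewrite ltnNge => /negP[]; apply: (@leq_trans 2) => //.
    apply: leq_trans card_scal; apply/subset_leq_card/subsetP => z Dz.
    have := all z; rewrite /= Dz /= => /negbFE sz; rewrite in_set sz andbT.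
    by case/setIP: Dz => /(subsetP (expgs_sub_group 2 sAG)).
  rewrite mem_cent1 => czy nsz.
  have Gz : z \in G by apply: subsetP A2z; apply: expgs_sub_group.
  apply/andP; split; first by apply/imsetP; exists (x * a); rewrite ?groupM // conjgM.
  rewrite /P /r; have -> : A ^+ 2 :&: 'C[y ^ a] = A ^+ 2 :&: 'C[z ^ a].
    apply/setP=> w; rewrite !in_setI !mem_cent1; congr (_ && _).
    have czya : commutes (z ^ a) (y ^ a) by rewrite commutesJ.
    apply/idP/idP=> h.
      by apply: (@commutes_trans (y ^ a)); rewrite ?scalJ.
    by apply: (@commutes_trans (z ^ a)); rewrite ?scalJ // commutesC.
  apply: torus_lower_bound => //; last by rewrite trJ; apply: reg_cent czy nsz.
  rewrite conjgE; apply: (@expgsD _ _ 1 3); first by rewrite expg1 -sA memV_invg.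
  by apply: (@expgsD _ _ 2 1); rewrite ?expg1.
have SG x : x \in G -> P (g ^ x).
  move=> Gx; have : G \subset 'N(S) by rewrite -genA gen_subG.
  move/subsetP/(_ x Gx); rewrite in_set => /subsetP/(_ (g ^ x)).
  rewrite memJ_conjg => h; have : g ^ x \in S.
    apply: h; rewrite in_set class_refl; exact: torus_lower_bound.
  by rewrite in_set => /andP[].
(* Double counting: a nonscalar [z] commutes with at most two conjugates of [g], since these lie in
   one torus and share their trace, while each conjugate [y] contributes at least [r y - 2]
   elements. *)
pose D := [set p in setX (g ^: G) (A ^+ 2) | commutes p.2 p.1 && ~~ scal p.2].
have classP y : y \in g ^: G -> [/\ y \in G, tr y = tr g, P y & ~~ scal y].
  case/imsetP=> x Gx ->; rewrite groupJ // trJ SG //; split=> //.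
  by rewrite scalJ reg_nonscal.
have hD : #|D| <= 2 * #|A ^+ 2|.
  apply: (@card_le_fibres _ _ snd) => [[? ?]|z A2z].
    by rewrite in_set => /andP[/setXP[]].
  set L := finset _.
  have LP p : p \in L -> [/\ p.1 \in g ^: G, p.2 = z, commutes z p.1 & ~~ scal z].
    case: p => y0 z0; rewrite in_set => /andP[+ /eqP /= e2].
    by rewrite in_set => /andP[/setXP[/= ? _]]; rewrite /= e2 => /andP[].
  have inj : {in L &, injective (@fst gT gT)}.
    by move=> [y1 z1] [y2 z2] /LP[/= _ -> _ _] /LP[/= _ -> _ _] /= ->.
  rewrite -(card_in_imset inj); apply: card_same_trace.
  - by move=> _ /imsetP[p /LP[cl _ _ _] ->]; case: (classP _ cl).
  - move=> _ _ /imsetP[p /LP[cl _ cz nsz] ->] /imsetP[p' /LP[cl' _ cz' _] ->].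
    have [_ -> _ _] := classP _ cl; have [_ -> _ _] := classP _ cl'; split=> //.
    by apply: (commutes_trans nsz); rewrite commutesC.
  - by move=> _ /imsetP[p /LP[cl _ _ _] ->]; have [_ -> _ _] := classP _ cl.
have cl0 : g \in g ^: G := class_refl G g.
have [y cly rmin] := @arg_minnP _ g (mem (g ^: G)) r cl0.
have hD2 : #|g ^: G| * (r y - 2) <= #|D|.
  rewrite (@sum_card_fibres _ _ fst D (g ^: G)); last first.
    by move=> [? ?]; rewrite in_set => /andP[/setXP[]].
  rewrite -sum_nat_const; apply: leq_sum => x clx.
  apply: leq_trans (leq_sub2r 2 (rmin x clx)) _.
  rewrite leq_subLR; set L := finset _.
  rewrite /r -(cardsID [set z in G | scal z]) leq_add //.
    by apply: leq_trans card_scal; apply/subset_leq_card/subsetIr.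
  have injx : injective (fun z : gT => (x, z)) by move=> ? ? [].
  rewrite -(card_imset _ injx); apply/subset_leq_card/subsetP => _ /imsetP[z + ->].
  case/setDP=> /setIP[A2z]; rewrite mem_cent1 in_set => cz.
  rewrite (subsetP (expgs_sub_group 2 sAG) _ A2z) /= => nsz.
  by rewrite !in_set /= clx A2z cz nsz eqxx.
have [_ _ Py _] := classP y cly; have r5 := P5 y Py.
have N2 : #|A ^+ 2| <= N by apply/subset_leq_card/expgs_subset.
have hcl := card_class Gg rg.
have e1 : q ^ 2 * r y <= 16 * N by exact: torus_count_arith hcl r5 (leq_trans hD2 hD) N2.
have e3 : (q ^ 2 * r y) ^ 3 <= (16 * N) ^ 3 by rewrite leq_exp2r.
rewrite (expnMn (q ^ 2)) (expnMn 16) -expnM in e3.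
have e4 := leq_mul (leqnn (q ^ (2 * 3))) Py.
apply: leq_trans e4 _.
rewrite mulnCA; apply: leq_trans (leq_mul (leqnn _) e3) _.
lia.
Qed.
End Growth.

(** * The hypotheses hold for SL_2 *)

Section SL2Hypotheses.
Variable F : finFieldType.
Local Notation gT := (GL2 F).
Local Notation G := (SL2_sub F).
Implicit Types (A : {set gT}) (g h u v x y z : gT).
Local Open Scope ring_scope.

Lemma eq_by_sub (c p x y : F) : p = 0 -> x - y = c * p -> x = y.
Proof. by move=> ->; rewrite mulr0 => /eqP; rewrite subr_eq0 => /eqP. Qed.

(* Over the algebraic closure, [u] and [v] share an eigenvector. *)
Definition csing u v := \det (GLval (u * v)%g - GLval (v * u)%g) == 0.

Lemma csingE u v : csing u v =
  ((eb u * ec v - ec u * eb v) ^+ 2 ==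
   ((ea u - ed u) * eb v - eb u * (ea v - ed v)) *
   ((ea u - ed u) * ec v - ec u * (ea v - ed v))).
Proof.
have E (M N : 'M[F]_2) i j : (M - N) i j = M i j - N i j by rewrite !mxE.
rewrite /csing det2E !E -!/(ea _) -!/(eb _) -!/(ec _) -!/(ed _).
rewrite !eaM !ebM !ecM !edM -[RHS]subr_eq0 -oppr_eq0; congr (_ == _); ring.
Qed.

Lemma GLdet_neq0 u : \det (GLval u) != 0.
Proof. exact: GL_det. Qed.

Lemma csingMr u v : csing u (u * v)%g = csing u v.
Proof.
rewrite /csing -mulgA !(GLvalM u) -mulmxBr det_mulmx mulf_eq0.
by rewrite (negPf (GLdet_neq0 _)).
Qed.

Lemma csingJ u v x : csing (u ^ x)%g (v ^ x)%g = csing u v.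
Proof.
rewrite /csing -!conjMg; set a := (u * v)%g; set b := (v * u)%g.
have conjE w : GLval x *m GLval (w ^ x)%g = GLval w *m GLval x.
  by rewrite -!GLvalM conjgE mulKVg.
rewrite -[LHS](orFb) -(negPf (GLdet_neq0 x)) -mulf_eq0 -det_mulmx mulmxBr !conjE.
by rewrite -mulmxBl det_mulmx mulf_eq0 (negPf (GLdet_neq0 x)) orbF.
Qed.

Lemma commutes_csing u v : commutes u v -> csing u v.
Proof. rewrite /commutes => /eqP e; rewrite /csing e subrr det0; exact: eqxx. Qed.

Definition eigenval t (l : F) := l ^+ 2 - t * l + 1 == 0.

(** Singularity reads p^2 = r s. If [r] were nonzero, [eb x * (p / r) + ed x] would be an eigenvalue
    of [x] in F; so [r] and [p] vanish, and then [s], because [eb x] is nonzero. *)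
Lemma csing_nonsplit x g : x \in G -> (forall l, ~~ eigenval (tr2 x) l) ->
  csing x g -> commutes x g.
Proof.
move=> /inSL2P dx ns; rewrite csingE => /eqP hk.
set p := eb x * ec g - ec x * eb g in hk.
set r := _ * eb g - _ in hk; set s := _ * ec g - _ in hk.
have rel : (ea x - ed x) * p = eb x * s - ec x * r by rewrite /p /r /s; ring.
have b0 : eb x != 0.
  apply: contra (ns (ea x)) => /eqP b0; rewrite /eigenval /tr2.
  apply/eqP; rewrite b0 mul0r addr0 in dx; ring: dx.
have r0 : r = 0.
  apply/eqP; apply: contraT => r0; case/negP: (ns (eb x * (p / r) + ed x)).
  have : eb x * (p / r) ^+ 2 - (ea x - ed x) * (p / r) - ec x = 0.
    apply: (mulfI r0); rewrite mulr0.
    transitivity ((eb x * p ^+ 2 / r) - (ea x - ed x) * p - ec x * r); first by field.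
    by rewrite rel hk; field.
  rewrite /eigenval /tr2 => e; apply/eqP.
  transitivity (eb x * (eb x * (p / r) ^+ 2 - (ea x - ed x) * (p / r) - ec x)
    + (1 + eb x * ec x - ea x * ed x)); first by ring.
  by rewrite e dx; ring.
have p0 : p = 0 by apply/eqP; move/eqP: hk; rewrite r0 mul0r expf_eq0.
have s0 : s = 0.
  by apply/eqP; move/eqP: rel; rewrite p0 r0 !mulr0 subr0 eq_sym mulf_eq0 (negPf b0).
apply/commuteE; split; apply/eqP; rewrite -subr_eq0; apply/eqP => //.
Qed.

(** The columns of P are eigenvectors for the distinct eigenvalues l and [tr2 x - l], read off a
    nonzero off-diagonal entry; if there is none, [x] is diagonal up to swapping the axes. P lies in
    GL_2 only, which suffices as [tr2], [scal] and [csing] are invariant under GL_2. *)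
Lemma diagonalise x l : x \in G -> eigenval (tr2 x) l -> tr2 x ^+ 2 != 4 ->
  exists P, [/\ ea (x ^ P)%g = l, eb (x ^ P)%g = 0, ec (x ^ P)%g = 0
              & ed (x ^ P)%g = tr2 x - l].
Proof.
move=> /inSL2P dx /eqP el t4.
have l2 : l - (tr2 x - l) != 0.
  apply: contraNneq t4 => e; rewrite -subr_eq0; apply/eqP.
  transitivity ((l - (tr2 x - l)) ^+ 2 - 4 * (l ^+ 2 - tr2 x * l + 1)); first by ring.
  by rewrite e el; ring.
have [D GD [da db dc dd]] : exists2 D, D \in G &
    [/\ ea D = l, eb D = 0, ec D = 0 & ed D = tr2 x - l].
  by apply: SL2_ex; apply: (eq_by_sub (c := -1) el); ring.
suff [P] : exists P, (x * P = P * D)%g.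
  by move=> e; exists P; rewrite conjgE e mulKg.
have [c0|c0] := eqVneq (ec x) 0; last first.
  have [|P [pa pb pc pd]] := @entries_mx2 _ (l - ed x) (tr2 x - l - ed x) (ec x) (ec x).
    rewrite (_ : _ - _ = (l - (tr2 x - l)) * ec x); first by rewrite mulf_neq0.
    by ring.
  exists P; apply: GL2P; rewrite ?(eaM, ebM, ecM, edM) ?pa ?pb ?pc ?pd ?da ?db ?dc ?dd;
    rewrite /tr2 in el *.
  - by apply: (eq_by_sub (c := -1) el); ring: dx.
  - by apply: (eq_by_sub (c := -1) el); ring: dx.
  - by ring.
  - by ring.
have [b0|b0] := eqVneq (eb x) 0; last first.
  have [|P [pa pb pc pd]] := @entries_mx2 _ (eb x) (eb x) (l - ea x) (tr2 x - l - ea x).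
    rewrite (_ : _ - _ = - ((l - (tr2 x - l)) * eb x)); last by ring.
    by rewrite oppr_eq0 mulf_neq0.
  exists P; apply: GL2P; rewrite ?(eaM, ebM, ecM, edM) ?pa ?pb ?pc ?pd ?da ?db ?dc ?dd;
    rewrite /tr2 in el *.
  - by ring.
  - by ring.
  - by apply: (eq_by_sub (c := -1) el); ring: dx.
  - by apply: (eq_by_sub (c := -1) el); ring: dx.
have : (l - ea x) * (l - ed x) = 0.
  by rewrite -el /tr2; rewrite b0 mul0r addr0 in dx; ring: dx.
move/eqP; rewrite mulf_eq0 !subr_eq0 => /orP[]/eqP le.
  exists 1%g; rewrite mulg1 mul1g; apply: GL2P; rewrite ?da ?db ?dc ?dd // /tr2 le; ring.
have [|P [pa pb pc pd]] := @entries_mx2 F 0 1 1 0; first by rewrite mul0r mul1r sub0r oppr_eq0 oner_neq0.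
exists P; apply: GL2P; rewrite ?(eaM, ebM, ecM, edM) ?pa ?pb ?pc ?pd ?da ?db ?dc ?dd ?b0 ?c0 /tr2 ?le; ring.
Qed.

(** t^2 - 4 is the discriminant of X^2 - t X + 1, so regular means distinct eigenvalues, also in
    characteristic 2. *)
Definition reg (t : F) := t ^+ 2 != 4.

Lemma reg_nonscal u : u \in G -> reg (tr2 u) -> ~~ scal u.
Proof.
move=> Gu; apply: contra => su; have := scalM1 Gu su.
case/and3P: su => _ _ /eqP e e2; apply/eqP.
by rewrite /tr2 -e; transitivity (4 * ea u ^+ 2); [ring | rewrite e2 mulr1].
Qed.

Lemma SL2J u P : u \in G -> (u ^ P)%g \in G.
Proof.
rewrite !inSL2_det => /eqP du; rewrite -(inj_eq (mulfI (GLdet_neq0 P))) -det_mulmx -GLvalM.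
by rewrite conjgE mulKVg GLvalM det_mulmx du mul1r mulr1.
Qed.

(** If [x] has no eigenvalue in F, [csing_nonsplit] allows u = v = x. Otherwise, in an eigenbasis of
    [x], singularity makes [g] triangular, and trace and determinant give it the diagonal of [x] or
    of x^-1; so x^-1 g or x g has equal diagonal entries and commutes with an upper or a lower
    unipotent. *)
Lemma sing_cover x : x \in G -> reg (tr2 x) ->
  exists u v, [/\ u \in G, v \in G, ~~ scal u, ~~ scal v &
    forall g, g \in G -> tr2 g = tr2 x -> csing x g ->
      [|| commutes (x^-1 * g)%g u, commutes (x * g)%g u,
          commutes (x^-1 * g)%g v | commutes (x * g)%g v]].
Proof.
move=> Gx rx; case: (pickP (eigenval (tr2 x))) => [l el|ns]; last first.
  have nsx := reg_nonscal Gx rx.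
  exists x, x; split=> // g Gg tg sg; apply/or4P; apply: Or41.
  have nl l : ~~ eigenval (tr2 x) l by rewrite ns.
  have cxg := csing_nonsplit Gx nl sg.
  exact (commutesMl cxg).
have [P [da db dc dd]] := diagonalise Gx el rx.
have [|u Gu [ua ub uc ud]] := @SL2_ex F 1 1 0 1; first by ring.
have [|v Gv [va vb vc vd]] := @SL2_ex F 1 0 1 1; first by ring.
exists (u ^ P^-1)%g, (v ^ P^-1)%g; split; rewrite ?scalJ ?SL2J //.
- by rewrite /scal ub oner_eq0.
- by rewrite /scal vc oner_eq0 andbF.
move=> g Gg tg sg.
rewrite !commutesJV !conjMg conjVg; set D := (x ^ P)%g in da db dc dd *; set h := (g ^ P)%g.
have Gh : h \in G by apply: SL2J.
have GD : D \in G by apply: SL2J.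
have th : tr2 h = tr2 x by rewrite tr2J.
have [va' vb' vc' vd'] := entriesV GD.
move/eqP: el => el.
have l2 : l - (tr2 x - l) != 0.
  apply: contraNneq rx => e; apply/eqP; apply: (eq_by_sub (c := -4) el).
  by transitivity ((l - (tr2 x - l)) ^+ 2 - 4 * (l ^+ 2 - tr2 x * l + 1)); [ring | rewrite e; ring].
have bc0 : eb h * ec h = 0.
  move: sg; rewrite -(csingJ x g P) -/D -/h csingE db dc da dd => /eqP e.
  apply: (mulfI (mulf_neq0 l2 l2)); rewrite mulr0; apply/eqP.
  rewrite -subr_eq0; apply/eqP.
  by transitivity (- ((0 * ec h - 0 * eb h) ^+ 2 - (l - (tr2 x - l)) * eb h * ((l - (tr2 x - l)) * ec h)));
    [ring | rewrite e; ring].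
have dh := inSL2P Gh; rewrite bc0 addr0 in dh.
clearbody h D; clear sg.
have eh : ed h = tr2 x - ea h by rewrite -th /tr2; ring.
have ah : (ea h == l) || (ea h == tr2 x - l).
  rewrite -subr_eq0 -[X in _ || X]subr_eq0 -mulf_eq0; apply/eqP.
  have dh' : ea h ^+ 2 = tr2 x * ea h - 1 by rewrite -dh eh; ring.
  by apply: (eq_by_sub (c := -1) el); ring: dh'.
have up w : ec w = 0 -> ea w = ed w -> commutes w u.
  by move=> c0 e; apply/commuteE; rewrite c0 e ua ub uc ud; split; ring.
have lo w : eb w = 0 -> ea w = ed w -> commutes w v.
  by move=> c0 e; apply/commuteE; rewrite c0 e va vb vc vd; split; ring.
move/eqP: bc0; rewrite mulf_eq0 => /orP[]/eqP z0; case/orP: ah => /eqP al; apply/or4P.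
- apply: Or43; apply: lo; rewrite ?eaM ?ebM ?edM ?va' ?vb' ?vc' ?vd' ?da ?db ?dc ?dd ?z0 ?eh ?al; ring.
- apply: Or44; apply: lo; rewrite ?eaM ?ebM ?edM ?da ?db ?dc ?dd ?z0 ?eh ?al; ring.
- apply: Or41; apply: up; rewrite ?eaM ?ecM ?edM ?va' ?vb' ?vc' ?vd' ?da ?db ?dc ?dd ?z0 ?eh ?al; ring.
- apply: Or42; apply: up; rewrite ?eaM ?ecM ?edM ?da ?db ?dc ?dd ?z0 ?eh ?al; ring.
Qed.

Lemma perp_line (b c e b' c' e' n1 n2 n3 : F) :
  let k1 := c * e' - e * c' in let k2 := e * b' - b * e' in let k3 := b * c' - c * b' in
  n1 * b + n2 * c + n3 * e = 0 -> n1 * b' + n2 * c' + n3 * e' = 0 ->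
  ~~ [&& k1 == 0, k2 == 0 & k3 == 0] ->
  exists s, [/\ n1 = s * k1, n2 = s * k2 & n3 = s * k3].
Proof.
move=> k1 k2 k3 h h' nk.
have x12 : n2 * k1 = n1 * k2.
  apply: (eq_by_sub (c := 1) (p := e' * (n1 * b + n2 * c + n3 * e) - e * (n1 * b' + n2 * c' + n3 * e'))).
    by rewrite h h'; ring.
  by rewrite /k1 /k2; ring.
have x13 : n3 * k1 = n1 * k3.
  apply: (eq_by_sub (c := 1) (p := c * (n1 * b' + n2 * c' + n3 * e') - c' * (n1 * b + n2 * c + n3 * e))).
    by rewrite h h'; ring.
  by rewrite /k1 /k3; ring.
have x23 : n3 * k2 = n2 * k3.
  apply: (eq_by_sub (c := 1) (p := b' * (n1 * b + n2 * c + n3 * e) - b * (n1 * b' + n2 * c' + n3 * e'))).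
    by rewrite h h'; ring.
  by rewrite /k2 /k3; ring.
have [z1|z1] := eqVneq k1 0; last first.
  by exists (n1 / k1); split; rewrite ?divfK // mulrAC -?x12 -?x13 mulfK.
have [z2|z2] := eqVneq k2 0; last first.
  exists (n2 / k2); split; rewrite ?divfK //; last by rewrite mulrAC -x23 mulfK.
  by rewrite mulrAC x12 mulfK.
have [z3|z3] := eqVneq k3 0; first by rewrite z1 z2 z3 !eqxx in nk.
exists (n3 / k3); split; rewrite ?divfK //; first by rewrite mulrAC x13 mulfK.
by rewrite mulrAC x23 mulfK.
Qed.

(** The three traces are linear conditions, so two solutions differ by a multiple [s] of the cross
    product (k1, k2, k3) of the vectors of [h] and [z]. Determinant 1 leaves a quadratic in [s] with
    root 0. *)
Lemma trace_line h z x y : h \in G -> z \in G -> x \in G -> y \in G -> ~~ commutes h z ->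
  tr2 x = tr2 y -> tr2 (x^-1 * h)%g = tr2 (y^-1 * h)%g ->
  tr2 (x^-1 * z)%g = tr2 (y^-1 * z)%g ->
  let k1 := ec h * (ea z - ed z) - (ea h - ed h) * ec z in
  let k2 := (ea h - ed h) * eb z - eb h * (ea z - ed z) in
  let k3 := eb h * ec z - ec h * eb z in
  exists s, [/\ ec y = ec x + s * k1, eb y = eb x + s * k2, ea y = ea x + s * k3,
    ed y = ed x - s * k3 &
    s * ((ea x - ed x) * k3 + eb x * k1 + ec x * k2) + s ^+ 2 * (k3 ^+ 2 + k1 * k2) = 0].
Proof.
move=> Gh Gz Gx Gy nc txy txh txz k1 k2 k3.
have dd : ed y - ed x = - (ea y - ea x).
  apply: (eq_by_sub (c := -1) (p := tr2 x - tr2 y)); first by rewrite txy subrr.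
  by rewrite /tr2; ring.
have perp w : tr2 (x^-1 * w)%g = tr2 (y^-1 * w)%g ->
    (ec y - ec x) * eb w + (eb y - eb x) * ec w + (ea y - ea x) * (ea w - ed w) = 0.
  move=> e; transitivity (tr2 (x^-1 * w)%g - tr2 (y^-1 * w)%g); last by rewrite e subrr.
  have [xa xb xc xd] := entriesV Gx; have [ya yb yc yd] := entriesV Gy.
  rewrite /tr2 !eaM !edM xa xb xc xd ya yb yc yd.
  transitivity ((ec y - ec x) * eb w + (eb y - eb x) * ec w - (ea y - ea x) * ed w - (ed y - ed x) * ea w).
    by rewrite dd; ring.
  by ring.
have [|s [s1 s2 s3]] := perp_line (perp h txh) (perp z txz).
  apply: contra nc => /and3P[]; rewrite !subr_eq0 => /eqP e1 /eqP e2 /eqP e3.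
  by apply/commuteE; rewrite e1 e2 e3.
exists s; rewrite -/k1 -/k2 -/k3 in s1 s2 s3.
have f1 : ec y = ec x + s * k1 by rewrite -s1; ring.
have f2 : eb y = eb x + s * k2 by rewrite -s2; ring.
have f3 : ea y = ea x + s * k3 by rewrite -s3; ring.
have f4 : ed y = ed x - s * k3 by rewrite -[ed y](subrK (ed x)) dd s3; ring.
split=> //; have := inSL2P Gy; have dx := inSL2P Gx; rewrite f1 f2 f3 f4 => e.
apply: (eq_by_sub (c := -1) (p := (ea x + s * k3) * (ed x - s * k3) - (1 + (eb x + s * k2) * (ec x + s * k1)))).
  by rewrite e subrr.
by ring: dx.
Qed.

(** Three solutions would give the quadratic of [trace_line] the roots 0, s and r, so it vanishes
    identically: the direction k is isotropic and orthogonal to [x]. Being orthogonal to [h] as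
    well, k is a multiple of the cross product of [x] and [h], whose isotropy is [csing x h]. *)
Lemma trace_fibre h z t : h \in G -> z \in G -> ~~ commutes h z ->
  (#|[set x in G | [&& tr2 x == t, tr2 (x^-1 * h)%g == t, tr2 (x^-1 * z)%g == t &
                      ~~ csing x h]]| <= 2)%N.
Proof.
move=> Gh Gz nc; rewrite leqNgt; apply/card_gt2P => -[x [y [w [[]]]]].
rewrite ![_ \in [set _ in _ | _]]in_set.
move=> /andP[Gx /and4P[/eqP tx /eqP txh /eqP txz nsx]].
move=> /andP[Gy /and4P[/eqP ty /eqP tyh /eqP tyz _]].
move=> /andP[Gw /and4P[/eqP tw /eqP twh /eqP twz _]] [xy yw wx].
have [s [s1 s2 s3 s4 s5]] : _ := trace_line Gh Gz Gx Gy nc (etrans tx (esym ty))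
  (etrans txh (esym tyh)) (etrans txz (esym tyz)).
have [r [r1 r2 r3 r4 r5]] : _ := trace_line Gh Gz Gx Gw nc (etrans tx (esym tw))
  (etrans txh (esym twh)) (etrans txz (esym twz)).
set k1 := _ - (ea h - ed h) * ec z in s1 s5 r1 r5.
set k2 := _ - eb h * (ea z - ed z) in s2 s5 r2 r5.
set k3 := _ - ec h * eb z in s3 s4 s5 r3 r4 r5.
set T := _ + ec x * k2 in s5 r5; set D := _ + k1 * k2 in s5 r5.
have s0 : s != 0.
  apply: contraNneq xy => s0; apply/eqP; apply: GL2P; rewrite ?s1 ?s2 ?s3 ?s4 s0; ring.
have r0 : r != 0.
  rewrite eq_sym in wx.
  apply: contraNneq wx => r0; apply/eqP; apply: GL2P; rewrite ?r1 ?r2 ?r3 ?r4 r0; ring.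
have sr : s - r != 0.
  rewrite subr_eq0; apply: contraNneq yw => e; apply/eqP; apply: GL2P;
    rewrite ?s1 ?s2 ?s3 ?s4 ?r1 ?r2 ?r3 ?r4 e; ring.
have s6 : T + s * D = 0 by apply: (mulfI s0); rewrite mulr0 -s5; ring.
have r6 : T + r * D = 0 by apply: (mulfI r0); rewrite mulr0 -r5; ring.
have D0 : D = 0.
  apply: (mulfI sr); rewrite mulr0.
  by transitivity ((T + s * D) - (T + r * D)); [ring | rewrite s6 r6 subrr].
have T0 : T = 0 by rewrite -s6 D0 mulr0 addr0.
case/negP: nsx; rewrite csingE.
set c1 := ec x * (ea h - ed h) - (ea x - ed x) * ec h.
set c2 := (ea x - ed x) * eb h - eb x * (ea h - ed h).
set c3 := eb x * ec h - ec x * eb h.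
case: (boolP [&& c1 == 0, c2 == 0 & c3 == 0]) => [/and3P[_ /eqP -> /eqP ->]|nc0].
  by rewrite mul0r expr2 mul0r.
have [||s' [e1 e2 e3]] := @perp_line (eb x) (ec x) (ea x - ed x) (eb h) (ec h) (ea h - ed h)
  k1 k2 k3 _ _ nc0.
- by rewrite -[RHS]T0 /T; ring.
- by rewrite /k1 /k2 /k3; ring.
rewrite -/c1 -/c2 -/c3 in e1 e2 e3.
have s'0 : s' != 0.
  apply: contra nc => /eqP s'0; apply/commuteE; move: e1 e2 e3.
  rewrite s'0 !mul0r => /eqP + /eqP + /eqP; rewrite !subr_eq0.
  by move=> /eqP e1 /eqP e2 /eqP e3; rewrite e1 e2 e3.
have : c3 ^+ 2 + c1 * c2 = 0.
  apply: (mulfI (mulf_neq0 s'0 s'0)); rewrite mulr0 -D0 /D e1 e2 e3; ring.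
move=> e; apply/eqP; apply: (eq_by_sub (c := 1) e); rewrite /c1 /c2 /c3; ring.
Qed.

Lemma sqr_eq0 (x : F) : x ^+ 2 = 0 -> x = 0.
Proof. by move/eqP; rewrite expf_eq0 => /eqP. Qed.

(** With t = 2 e and e^2 = 1, the matrices y - e and z - e are nilpotent, and the last trace makes
    them orthogonal for the trace form. The three minors measuring their non-proportionality then
    have square zero. In characteristic 2, e = 1. *)
Lemma parabolic_commutes y z t : y \in G -> z \in G -> t ^+ 2 = 4 ->
  tr2 y = t -> tr2 z = t -> tr2 (z * y^-1)%g = 2 -> commutes z y.
Proof.
move=> Gy Gz t4 ty tz tzy.
have [e t2e e1] : exists2 e : F, t = 2 * e & e ^+ 2 = 1.
  have [two0|two0] := eqVneq (2 : F) 0.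
    exists 1; last by rewrite expr1n.
    rewrite two0 mul0r; apply: sqr_eq0; rewrite t4.
    by transitivity (2 * 2 : F); [ring | rewrite two0 mul0r].
  exists (t / 2); first by rewrite mulrCA divff ?mulr1.
  rewrite expr_div_n t4; apply/eqP; rewrite -(inj_eq (mulIf (expf_neq0 2 two0))) divfK ?expf_neq0 //.
  by rewrite mul1r; apply/eqP; ring.
have yd : ed y = 2 * e - ea y by rewrite -t2e -ty /tr2; ring.
have zd : ed z = 2 * e - ea z by rewrite -t2e -tz /tr2; ring.
set p := ea y - e; set r := ea z - e.
have ya : ea y = p + e by rewrite /p; ring.
have za : ea z = r + e by rewrite /r; ring.
have py : p ^+ 2 = - (eb y * ec y).
  have := inSL2P Gy; rewrite yd ya => h.
  have h' : p ^+ 2 = e ^+ 2 - (p + e) * (2 * e - (p + e)) by ring.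
  by rewrite h' h e1; ring.
have pz : r ^+ 2 = - (eb z * ec z).
  have := inSL2P Gz; rewrite zd za => h.
  have h' : r ^+ 2 = e ^+ 2 - (r + e) * (2 * e - (r + e)) by ring.
  by rewrite h' h e1; ring.
have pr : eb z * ec y + ec z * eb y = - (2 * p * r).
  have [va vb vc vd] := entriesV Gy.
  move: tzy; rewrite /tr2 eaM edM va vb vc vd yd zd ya za => h.
  apply: (eq_by_sub (c := -1) (p := (r + e) * (2 * e - (p + e)) + eb z * - ec y +
    (ec z * - eb y + (2 * e - (r + e)) * (p + e)) - 2)); first by rewrite h subrr.
  by ring: e1.
clearbody p r.
have k1 : eb z * ec y - ec z * eb y = 0.
  apply: sqr_eq0; transitivity ((eb z * ec y + ec z * eb y) ^+ 2 - 4 * (eb y * ec y) * (eb z * ec z)).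
    by ring.
  rewrite pr; transitivity (4 * (p ^+ 2 * r ^+ 2 - (eb y * ec y) * (eb z * ec z))); first by ring.
  by rewrite py pz; ring.
have k2 : r * eb y - eb z * p = 0.
  apply: sqr_eq0; transitivity (r ^+ 2 * eb y ^+ 2 + eb z ^+ 2 * p ^+ 2 - (2 * p * r) * (eb y * eb z)).
    by ring.
  by rewrite -[2 * p * r]opprK -pr py pz; ring.
have k3 : r * ec y - ec z * p = 0.
  apply: sqr_eq0; transitivity (r ^+ 2 * ec y ^+ 2 + ec z ^+ 2 * p ^+ 2 - (2 * p * r) * (ec y * ec z)).
    by ring.
  by rewrite -[2 * p * r]opprK -pr py pz; ring.
apply/commuteE; rewrite yd zd ya za; split.
- by apply/eqP; rewrite -subr_eq0 k1.
- by apply: (eq_by_sub (c := 2) k2); ring.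
- by apply: (eq_by_sub (c := 2) k3); ring.
Qed.

(** If [y] is not regular, tr (z y) + tr (z y^-1) = tr z tr y = 4. If neither product is regular
    either, b = tr (z y^-1) satisfies b^2 = (4 - b)^2 = 4, whence 8 (b - 2) = 0 and (b - 2)^3 = 0.
    So b = 2 in every characteristic, and [parabolic_commutes] applies. *)
Lemma escape y z : y \in G -> z \in G -> ~~ commutes z y -> tr2 z = tr2 y ->
  [|| reg (tr2 y), reg (tr2 (z * y)%g) | reg (tr2 (z * y^-1)%g)].
Proof.
move=> Gy Gz nc tzy; apply: contraR nc.
rewrite !negb_or !negbK => /and3P[/eqP ty /eqP tz /eqP tzV].
have sum : tr2 (z * y)%g + tr2 (z * y^-1)%g = 4.
  have [ya yb yc yd] := entriesV Gy; rewrite -ty expr2 -{1}tzy.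
  by rewrite /tr2 !eaM !edM ya yb yc yd; ring.
apply: (parabolic_commutes Gy Gz ty) => //.
set a := tr2 (z * y)%g in tz sum; set b := tr2 (z * y^-1)%g in tzV sum *.
have ea : a = 4 - b by rewrite -sum; ring.
have h8 : 8 * (b - 2) = 0.
  apply: (eq_by_sub (c := 1) (p := (b ^+ 2 - 4) - (a ^+ 2 - 4))); first by rewrite tz tzV; ring.
  by rewrite ea; ring.
have h3 : (b - 2) ^+ 3 = 0.
  apply: (eq_by_sub (c := 1) (p := (b ^+ 2 - 4) * (b - 6) + 2 * (8 * (b - 2)))).
    by rewrite h8 tzV; ring.
  by ring.
by apply/eqP; rewrite -subr_eq0; move/eqP: h3; rewrite expf_eq0.
Qed.

(** The vectors (b, c, a - d) of [z] and [y] are proportional and the discriminant is a quadratic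
    form in them; it can vanish at [z] only if the vector of [z] is zero. *)
Lemma reg_cent y z : y \in G -> z \in G -> reg (tr2 y) -> commutes z y -> ~~ scal z ->
  reg (tr2 z).
Proof.
move=> Gy Gz ry cz nsz; apply: contra nsz => /eqP tz.
have dz := inSL2P Gz; have dy := inSL2P Gy.
case/commuteE: cz => k1 k2 k3.
have disc u : u \in G -> tr2 u ^+ 2 - 4 = (ea u - ed u) ^+ 2 + 4 * (eb u * ec u).
  move/inSL2P=> du; rewrite /tr2; transitivity ((ea u + ed u) ^+ 2 - 4 * (ea u * ed u) + 4 * (eb u * ec u)).
    by rewrite du; ring.
  by ring.
have dz0 : (ea z - ed z) ^+ 2 + 4 * (eb z * ec z) = 0 by rewrite -disc // tz subrr.
have dy0 : (ea y - ed y) ^+ 2 + 4 * (eb y * ec y) != 0 by rewrite -disc // subr_eq0.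
have vanish (x : F) : x ^+ 2 * ((ea y - ed y) ^+ 2 + 4 * (eb y * ec y)) = 0 -> x == 0.
  by move/eqP; rewrite mulf_eq0 (negPf dy0) orbF expf_eq0.
rewrite /scal; apply/and3P; split.
- apply: vanish; transitivity ((eb z * (ea y - ed y)) ^+ 2 + 4 * (eb z * eb y * (eb z * ec y))); first by ring.
  rewrite -k2 k1; apply: (eq_by_sub (c := eb y ^+ 2) dz0); ring.
- apply: vanish; transitivity ((ec z * (ea y - ed y)) ^+ 2 + 4 * (ec z * ec y * (ec z * eb y))); first by ring.
  rewrite -k3 -k1; apply: (eq_by_sub (c := ec y ^+ 2) dz0); ring.
- rewrite -subr_eq0; apply: vanish.
  transitivity ((ea z - ed z) ^+ 2 * (ea y - ed y) ^+ 2 +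
    4 * (((ea z - ed z) * eb y) * ((ea z - ed z) * ec y))); first by ring.
  rewrite k2 k3; apply: (eq_by_sub (c := (ea y - ed y) ^+ 2) dz0); ring.
Qed.

(** The difference x of the upper left entries satisfies 2 x = 0 and x (tr y + x) = 0. In odd
    characteristic x = 0; in characteristic 2 also x = tr y is possible, and it gives y^-1. *)
Lemma same_offdiag y z : y \in G -> z \in G -> reg (tr2 y) -> tr2 z = tr2 y ->
  eb z = eb y -> ec z = ec y -> ea z - ed z = ea y - ed y -> (z == y) || (z == y^-1%g).
Proof.
move=> Gy Gz ry; have dy := inSL2P Gy; have dz := inSL2P Gz.
rewrite /reg /tr2 in ry * => t eb' ec' e'; rewrite eb' ec' in dz.
have dd : ed z = ed y + (ea z - ea y).
  by apply: (eq_by_sub (c := -1) (p := (ea z - ed z) - (ea y - ed y))); [rewrite e' subrr | ring].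
set x := ea z - ea y in dd; have da : ea z = ea y + x by rewrite /x; ring.
have x2 : 2 * x = 0.
  apply: (eq_by_sub (c := 1) (p := (ea z + ed z) - (ea y + ed y))); first by rewrite t subrr.
  by rewrite dd da; ring.
have : x * (ea y + ed y + x) = 0.
  rewrite da dd in dz; apply: (eq_by_sub (c := 1) (p := (ea y + x) * (ed y + x) - (1 + eb y * ec y))).
    by rewrite dz subrr.
  by ring: dy.
clearbody x; move/eqP; rewrite mulf_eq0 => /orP[/eqP x0|/eqP xt].
  by apply/orP; left; apply/eqP/GL2P; rewrite ?eb' ?ec' ?da ?dd ?x0 ?addr0.
have xE : x = - (ea y + ed y) by rewrite -[LHS](addKr (ea y + ed y)) xt addr0.
have [two0|two0] := eqVneq (2 : F) 0; last first.
  have x0 : x = 0 by apply: (mulfI two0); rewrite mulr0.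
  by apply/orP; left; apply/eqP/GL2P; rewrite ?eb' ?ec' ?da ?dd ?x0 ?addr0.
have opp w : - w = w :> F.
  by apply: (eq_by_sub (c := 1) (p := - 2 * w)); [rewrite two0 oppr0 mul0r | ring].
have [ya yb yc yd] := entriesV Gy.
have e1 : ea y + x = ed y by rewrite xE -[RHS]opp; ring.
have e2 : ed y + x = ea y by rewrite xE -[RHS]opp; ring.
by apply/orP; right; apply/eqP/GL2P; rewrite ?ya ?yb ?yc ?yd ?eb' ?ec' ?da ?dd ?e1 ?e2 ?opp.
Qed.

(** The vector (b, c, a - d) of [z] is [s] times that of [y], and equal discriminants force s = 1 or
    s = -1; the latter is the former for y^-1. *)
Lemma same_trace y z : y \in G -> z \in G -> reg (tr2 y) -> commutes z y ->
  tr2 z = tr2 y -> (z == y) || (z == y^-1%g).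
Proof.
move=> Gy Gz ry c; case/commuteE: c => k1 k2 k3 tzy.
have nsy := reg_nonscal Gy ry.
have [s [s1 s2 s3]] : exists s, [/\ eb z = s * eb y, ec z = s * ec y &
    ea z - ed z = s * (ea y - ed y)].
  have [b0|b0] := eqVneq (eb y) 0; last first.
    exists (eb z / eb y); split; first by rewrite divfK.
      by rewrite mulrAC k1 mulfK.
    by rewrite mulrAC -k2 mulfK.
  have [c0|c0] := eqVneq (ec y) 0; last first.
    exists (ec z / ec y); split; last by rewrite mulrAC -k3 mulfK.
      by rewrite mulrAC -k1 mulfK.
    by rewrite divfK.
  have e0 : ea y - ed y != 0 by apply: contra nsy; rewrite subr_eq0 /scal b0 c0 eqxx.
  exists ((ea z - ed z) / (ea y - ed y)); split; last by rewrite divfK.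
    by rewrite mulrAC k2 mulfK.
  by rewrite mulrAC k3 mulfK.
have disc u : u \in G -> tr2 u ^+ 2 - 4 = (ea u - ed u) ^+ 2 + 4 * (eb u * ec u).
  move/inSL2P=> du; rewrite /tr2; transitivity ((ea u + ed u) ^+ 2 - 4 * (ea u * ed u) + 4 * (eb u * ec u)).
    by rewrite du; ring.
  by ring.
have : (tr2 y ^+ 2 - 4) * ((s - 1) * (s + 1)) = 0.
  apply: (eq_by_sub (c := 1) (p := s ^+ 2 * (tr2 y ^+ 2 - 4) - (tr2 z ^+ 2 - 4))); last by rewrite tzy; ring.
  by rewrite !disc // s1 s2 s3; ring.
move/eqP; rewrite !mulf_eq0 [tr2 y ^+ 2 - 4 == 0]subr_eq0 (negPf ry) /=.
rewrite subr_eq0 addr_eq0 => /orP[]/eqP es; rewrite es ?mulN1r ?mul1r in s1 s2 s3.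
  exact: same_offdiag.
have [ya yb yc yd] := entriesV Gy.
rewrite orbC -{2}[y]invgK; apply: same_offdiag; rewrite ?groupV //.
- by rewrite tr2V.
- by rewrite tr2V.
- by rewrite yb.
- by rewrite yc.
- by rewrite s3 ya yd opprB.
Qed.

(* The lower bound counts the matrices with nonzero upper left entry. *)
Lemma card_SL2_ge : (#|F| ^ 3 <= 2 * #|G|)%N.
Proof.
have q2 : (1 < #|F|)%N by apply: card_finNzRing_gt1.
have h : (#|[set~ (0%R : F)]| * (#|F| * #|F|) <= #|G|)%N.
  rewrite -[X in (_ * (X * _) <= _)%N]cardsT -[X in (_ * (_ * X) <= _)%N]cardsT -!cardsX.
  pose f (p : F * (F * F)) : GL2 F :=
    odflt 1%g [pick u in G | [&& ea u == p.1, eb u == p.2.1 & ec u == p.2.2]].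
  have fP p : p \in setX [set~ (0%R : F)] (setX setT setT) ->
      [/\ f p \in G, ea (f p) = p.1, eb (f p) = p.2.1 & ec (f p) = p.2.2].
    case: p => a [b c] /setXP[a0 _]; rewrite /f /=; case: pickP => [u /= /and4P[Gu]|none].
      by move=> /eqP-> /eqP-> /eqP->.
    rewrite in_setC1 in a0.
    have [|u Gu [ua ub uc ud]] := @SL2_ex F a b c ((1 + b * c) / a).
      by rewrite mulrCA divff // mulr1; ring.
    by have := none u; rewrite /= Gu ua ub uc !eqxx.
  have inj : {in setX [set~ (0%R : F)] (setX setT setT) &, injective f}.
    move=> p r /fP[_ pa pb pc] /fP[_ ra rb rc] e.
    rewrite e in pa pb pc; case: p r pa pb pc ra rb rc {e} => [? [? ?]] [? [? ?]] /=.
    by move=> -> -> -> -> -> ->.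
  rewrite -(card_in_imset inj); apply/subset_leq_card/subsetP => _ /imsetP[p /fP[Gp _ _ _] ->].
  exact: Gp.
apply: leq_trans (leq_mul (leqnn 2) h); rewrite cardsC1 mulnA !expnS expn0 muln1.
by rewrite leq_mul // ; case: #|F| q2 => [|[|n]] //= _; lia.
Qed.
End SL2Hypotheses.

Section SL2Growth.
Variable F : finFieldType.
Implicit Type A : {set GL2 F}.
Local Open Scope group_scope.

Lemma scal_commutes (z u : GL2 F) : scal z -> commutes z u.
Proof. by move=> sz; apply/eqP/scal_commute. Qed.

Lemma SL2_symmetric_growth A : 2 < #|F| -> A^-1 = A -> 1 \in A ->
  <<A>> = SL2_sub F ->
  #|A| ^ 3 <= 2 ^ 18 * #|A ^+ 30| ^ 2 \/
  #|F| ^ 6 * #|A| ^ 3 <= 2 ^ 23 * #|A ^+ 30| ^ 5.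
Proof.
move=> q2 sA A1 genA; apply: (@symmetric_growth _ (SL2_sub F) F (@tr2 F) (@scal F) (@csing F) (@reg F)) .
- exact: scal_commutes.
- exact: scalJ.
- exact: card_scal.
- by move=> z u v nz /eqP uz /eqP vz; apply/eqP/(commute_trans nz).
- by move=> y Gy nsy; have [g Gg nc] := exists_noncommuting_conj q2 Gy nsy; exists g.
- exact: commutes_csing.
- exact: csingMr.
- exact: sing_cover.
- exact: trace_fibre.
- exact: tr2J.
- exact: reg_nonscal.
- exact: escape.
- exact: reg_cent.
- exact: same_trace.
- exact: leqnn.
- exact: card_SL2_ge.
- exact: sA.
- exact: A1.
- exact: genA.
have [|u Gu [ua ub uc ud]] := @SL2_ex F 1%R 1%R 0%R 1%R; first by rewrite mulr1 mulr0 subr0.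
by exists u => //; rewrite /scal ub oner_eq0.
Qed.
End SL2Growth.

(** * From symmetric to arbitrary generating sets *)

Section Tripling.
Variables (gT : finGroupType) (A : {set gT}).
Hypothesis A1 : (1 \in A)%g.
Local Open Scope group_scope.
Let B := A :|: A^-1.
Let a := #|A|.
Let t := #|A ^+ 3|.

Lemma sym_closure_invg : B^-1 = B.
Proof. by apply/setP=> x; rewrite mem_invg !in_setU !mem_invg invgK orbC. Qed.

(** Up to inversion these are all the words of length three in A and A^-1. One use of the triangle
    inequality moves an inverse at an end; the alternating word needs two. *)
Lemma word_bound (X : {set gT}) :
  X \in [:: A * A * A; A * A * A^-1; A * A^-1 * A; A^-1 * A * A] ->
  #|X| * a ^ 2 <= t ^ 3.
Proof.
have at_ : a <= t by apply: subset_leq_card; apply: subset_expgs.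
have AA : #|A * A| <= t.
  by apply: subset_leq_card; apply: (@expgs_subset _ A 2 3).
have AAA : A * A * A = A ^+ 3 by rewrite -mulgA.
have AA' : #|A^-1 * A^-1| <= t by rewrite -invMg card_invg.
have h1 : #|A * A * A^-1| * a <= t * t.
  have := ruzsa_triangle (A * A) A^-1 A^-1; rewrite invgK AAA card_invg => h.
  by apply: leq_trans h _; rewrite leq_mul.
have h2 : #|A^-1 * A * A| * a <= t * t.
  have := ruzsa_triangle A^-1 A (A * A); rewrite !mulgA AAA => h.
  by apply: leq_trans h _; rewrite leq_mul.
have h3 : #|A * A^-1 * A| * a <= t * #|A^-1 * A * A|.
  have := ruzsa_triangle A A^-1 (A^-1 * A); rewrite invgK mulgA card_invg => h.
  apply: leq_trans h _; rewrite leq_mul //.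
  by rewrite -(card_invg (A^-1 * A * A)) !invMg invgK mulgA.
have t3 : (t ^ 3 = t * t * t)%N by rewrite !expnS expn0 muln1 mulnA.
rewrite t3 -mulnn mulnA !inE => /or4P[]/eqP->.
- by rewrite AAA; apply: leq_mul (leq_mul _ at_) at_.
- exact: leq_mul h1 at_.
- apply: leq_trans (leq_mul h3 (leqnn a)) _.
  by rewrite -mulnA -[X in _ <= X]mulnA leq_mul.
- exact: leq_mul h2 at_.
Qed.

Lemma sym_tripling : #|B ^+ 3| * a ^ 2 <= 8 * t ^ 3.
Proof.
have cU (X Y : {set gT}) x y : #|X| * a ^ 2 <= x * t ^ 3 -> #|Y| * a ^ 2 <= y * t ^ 3 ->
    #|X :|: Y| * a ^ 2 <= (x + y) * t ^ 3.
  move=> hX hY; rewrite mulnDl; apply: leq_trans (leq_add hX hY).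
  by rewrite -mulnDl leq_mul // cardsU leq_subr.
have wb (X : {set gT}) :
   (X \in [:: A * A * A; A * A * A^-1; A * A^-1 * A; A^-1 * A * A]) ||
   (X^-1 \in [:: A * A * A; A * A * A^-1; A * A^-1 * A; A^-1 * A * A]) ->
   #|X| * a ^ 2 <= 1 * t ^ 3.
  by rewrite mul1n => /orP[|]/word_bound //; rewrite card_invg.
have -> : B ^+ 3 = B * B * B by rewrite -mulgA.
have -> : B * B = (A * A :|: A * A^-1) :|: (A^-1 * A :|: A^-1 * A^-1).
  by rewrite /B mulUg !mulgU.
rewrite !mulUg /B !mulgU.
have pair (X Y : {set gT}) : #|X| * a ^ 2 <= 1 * t ^ 3 -> #|Y| * a ^ 2 <= 1 * t ^ 3 ->
    #|X :|: Y| * a ^ 2 <= 2 * t ^ 3 by apply: cU.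
by apply: (@cU _ _ 4 4); apply: (@cU _ _ 2 2); apply: pair;
  apply: wb; rewrite !invMg ?invgK !mulgA !inE !eqxx ?orbT.
Qed.

Lemma sym_powers n : #|B ^+ n.+3| * #|B| ^ n <= #|B ^+ 3| ^ n.+1.
Proof.
elim: n => [|n IHn]; first by rewrite expn0 muln1 expn1.
have := ruzsa_triangle (B ^+ n.+2) B (B ^+ 2).
rewrite sym_closure_invg -expgD addn2 -expgSr -expgS => h.
rewrite expnS mulnA; apply: leq_trans (leq_mul h (leqnn _)) _.
by rewrite mulnAC (expnSr _ n.+1) leq_mul.
Qed.

End Tripling.

Section TriplingGrowth.

Lemma leq_exp2rW m n e : m <= n -> m ^ e <= n ^ e.
Proof. by case: e => // e; rewrite leq_exp2r. Qed.

Lemma tripling_arith (c1 c2 k l m j z : nat) a b t N :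
  a <= b -> b ^ k <= c1 * N ^ m -> N * b ^ l * a ^ j <= c2 * t ^ z ->
  a ^ (k + l * m + j * m) <= c1 * c2 ^ m * t ^ (z * m).
Proof.
move=> ab h1 h2; rewrite !expnD !expnM.
apply: (@leq_trans (b ^ k * (b ^ l) ^ m * (a ^ j) ^ m)).
  by rewrite !leq_mul // !leq_exp2rW.
apply: (@leq_trans (c1 * (N * b ^ l * a ^ j) ^ m)).
  by rewrite !expnMn !mulnA !leq_mul.
by rewrite -[X in _ <= X]mulnA leq_mul // -expnMn leq_exp2rW.
Qed.

(** The alternatives are raised to the powers 19 and 11 to meet in one inequality: 57 = 3 * 19, and
    in the second case q^66 >= n^24 supplies 57 = 24 + 33. *)
Lemma growth_arith n N q c : q ^ 11 >= n ^ 4 -> 0 < N ->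
  n ^ 3 <= c * N ^ 2 \/ q ^ 6 * n ^ 3 <= c * N ^ 5 ->
  n ^ 57 <= c ^ 19 * N ^ 55.
Proof.
move=> nq N0 [h|h]; last first.
  have c0 : c ^ 11 <= c ^ 19 by case: (c) => // c'; rewrite leq_pexp2l.
  apply: leq_trans (leq_mul c0 (leqnn _)).
  rewrite (_ : 55 = 5 * 11) // expnM -expnMn.
  apply: leq_trans (leq_exp2rW 11 h); rewrite expnMn -!expnM.
  rewrite (_ : 57 = 24 + 33) // expnD leq_mul //.
  by rewrite (_ : 24 = 4 * 6) // (_ : 6 * 11 = 11 * 6) // !expnM leq_exp2rW.
rewrite (_ : 57 = 3 * 19) // expnM; apply: leq_trans (leq_exp2rW 19 h) _.
by rewrite expnMn leq_mul // -expnM leq_pexp2l.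
Qed.

Lemma tripling_growth : exists C e, 0 < e /\
  forall (F : finFieldType) (A : {set GL2 F}), 2 < #|F| -> (1 \in A)%g ->
    (<<A>> = SL2_sub F)%g -> (2 * #|A|) ^ 4 <= #|F| ^ 11 ->
    #|A| ^ (e + 2) <= C * #|(A ^+ 3)%g| ^ e.
Proof.
have [c c18 c23] : exists2 c, 2 ^ 18 <= c & 2 ^ 23 <= c.
  by exists (2 ^ 23); [apply: leq_pexp2l | apply: leqnn].
(* The powers of |A| are 57 from the growth of B, 27 * 55 from [sym_powers] at n = 27 and 2 * 28 *
   55 from [sym_tripling]; their sum exceeds 3 * 28 * 55 by 57 - 55 = 2. *)
exists (c ^ 19 * (8 ^ 28) ^ 55), (3 * 28 * 55); split; first exact: isT.
move=> F A q2 A1 genA Aq.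
pose B := (A :|: A^-1)%g.
have AB : A \subset B by apply: subsetUl.
have leAB : #|A| <= #|B| by apply: subset_leq_card.
have B1 : (1 \in B)%g by apply: subsetP AB _ A1.
have genB : (<<B>> = SL2_sub F)%g.
  apply/eqP; rewrite -genA eqEsubset gen_subG subUset subset_gen genS //= andbT.
  by rewrite -(invGid <<A>>%G) invSg subset_gen.
have Bq : #|B| ^ 4 <= #|F| ^ 11.
  apply: leq_trans Aq; apply: leq_exp2rW; rewrite mul2n -addnn -{2}(card_invg A).
  by rewrite cardsU leq_subr.
have N0 : 0 < #|(B ^+ 30)%g| by apply/card_gt0P; exists 1%g; apply: mem_expgs1.
have h1 : #|B| ^ 57 <= c ^ 19 * #|(B ^+ 30)%g| ^ 55.
  apply: growth_arith Bq N0 _; case: (SL2_symmetric_growth q2 (sym_closure_invg A) B1 genB) => h.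
    by left; apply: leq_trans h (leq_mul c18 (leqnn _)).
  by right; apply: leq_trans h (leq_mul c23 (leqnn _)).
have h2 : #|(B ^+ 30)%g| * #|B| ^ 27 * #|A| ^ (2 * 28) <= 8 ^ 28 * #|(A ^+ 3)%g| ^ (3 * 28).
  rewrite !expnM -expnMn; apply: leq_trans (leq_exp2rW 28 (sym_tripling A1)).
  by rewrite expnMn leq_mul // sym_powers.
have := tripling_arith leAB h1 h2.
by rewrite (_ : 57 + 27 * 55 + 2 * 28 * 55 = 3 * 28 * 55 + 2) //; lia.
Qed.

End TriplingGrowth.

(** * Large sets *)

Section Affine.
Variable F : finFieldType.
Local Open Scope ring_scope.
Local Notation q := #|F|.
Implicit Types X Xi : {set F}.

Definition dil_sum X (xi : F) : {set F} := [set p.1 + xi * p.2 | p in setX X X].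

(** If the second coordinates agree, so do the first, and xi is free; otherwise the four elements
    determine xi. *)
Lemma card_collisions X :
  (#|[set r in setX [set~ 0%R] (setX (setX X X) (setX X X)) |
       (r.2.1.1 + r.1 * r.2.1.2 == r.2.2.1 + r.1 * r.2.2.2)%R]|
   <= q.-1 * #|X| ^ 2 + #|X| ^ 4)%N.
Proof.
set T := finset _; pose D := [set r : F * ((F * F) * (F * F)) | r.2.1.2 == r.2.2.2].
have TP r : r \in T -> [/\ r.1 != 0, r.2.1 \in setX X X, r.2.2 \in setX X X &
    r.2.1.1 + r.1 * r.2.1.2 = r.2.2.1 + r.1 * r.2.2.2].
  case: r => xi [p p']; rewrite in_set => /andP[/setXP[+ /setXP[]]] /=.
  by rewrite in_setC1 => ? ? ? /eqP.
rewrite -(cardsID D T) leq_add //.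
  rewrite -(cardsC1 (0%R : F)) -mulnn -!cardsX.
  have inj : {in T :&: D &, injective (fun r => (r.1, r.2.1))}.
    move=> [xi [[a b] [c d]]] [xi' [[a' b'] [c' d']]] /setIP[/TP[_ _ _ /= e]].
    rewrite in_set /= => /eqP bd /setIP[/TP[_ _ _ /= e']]; rewrite in_set /= => /eqP bd' [].
    move: e e'; rewrite bd bd' => /addIr -> /addIr -> -> ac db.
    by rewrite ac db.
  rewrite -(card_in_imset inj); apply/subset_leq_card/subsetP => _ /imsetP[r /setIP[/TP[r0 r1 _ _] _] ->].
  by rewrite /= in_setX in_setC1 r0.
rewrite (_ : 4 = 2 + 2)%N // expnD -mulnn -!cardsX.
have inj : {in T :\: D &, injective (fun r => r.2)}.
  move=> [xi [[a b] [c d]]] [xi' [[a' b'] [c' d']]] /setDP[/TP[_ _ _ /= e]].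
  rewrite in_set /= => bd /setDP[/TP[_ _ _ /= e'] _] [ea eb ec ed].
  subst a' b' c' d'; congr (_, _).
  rewrite -subr_eq0 in bd; apply: (mulIf bd).
  by transitivity (c - a); [apply: (eq_by_sub (c := 1) (p := (a + xi * b) - (c + xi * d)));
    [rewrite e subrr | ring] | apply: (eq_by_sub (c := -1) (p := (a + xi' * b) - (c + xi' * d)));
    [rewrite e' subrr | ring]].
rewrite -(card_in_imset inj); apply/subset_leq_card/subsetP => _ /imsetP[r /setDP[/TP[_ r1 r2 _] _] ->].
by rewrite /= inE r1.
Qed.

(** Every nonzero xi has additive energy at least |X|^4 / q, and twice that if its sum set has at
    most q / 2 elements. If all xi in [Xi] were of the second kind, the total would exceed
    [card_collisions]. *)
Lemma exists_large_dil_sum X Xi : 0 \notin Xi ->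
  (q ^ 2 + #|X| ^ 2 < #|Xi| * #|X| ^ 2)%N ->
  exists2 xi, xi \in Xi & (q < 2 * #|dil_sum X xi|)%N.
Proof.
move=> Xi0 big; case: (pickP [pred xi in Xi | (q < 2 * #|dil_sum X xi|)%N]) => [xi /andP[]|small].
  by exists xi.
pose E (xi : F) := #|[set p in setX (setX X X) (setX X X) |
   p.1.1 + xi * p.1.2 == p.2.1 + xi * p.2.2]|.
have CS xi : (#|X| ^ 4 <= #|dil_sum X xi| * E xi)%N.
  have := @collision_bound _ _ (fun p => p.1 + xi * p.2) (setX X X) (dil_sum X xi).
  rewrite cardsX mulnn -expnM; apply=> p Xp; exact: imset_f.
have sumE : (\sum_(xi in [set~ 0%R : F]) E xi <= q.-1 * #|X| ^ 2 + #|X| ^ 4)%N.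
  apply: leq_trans (card_collisions X).
  rewrite (@sum_card_fibres _ _ fst _ [set~ 0%R]); last first.
    by move=> [xi p]; rewrite in_set => /andP[/setXP[]].
  apply: leq_sum => xi xi0; rewrite /E.
  have inj : injective (fun p : (F * F) * (F * F) => (xi, p)) by move=> ? ? [].
  rewrite -(card_imset _ inj); apply/subset_leq_card/subsetP => _ /imsetP[p + ->].
  rewrite [_ \in [set p in _ | _]]in_set => /andP[Xp Ep].
  by rewrite in_set eqxx andbT in_set /= Ep andbT in_setX xi0 Xp.
have lowE : ((q.-1 + #|Xi|) * #|X| ^ 4 <= q * \sum_(xi in [set~ 0%R : F]) E xi)%N.
  rewrite big_distrr -(cardsC1 (0%R : F)) mulnDl /= -sum_nat_const.
  have -> : (#|Xi| * #|X| ^ 4 = \sum_(xi in [set~ 0%R : F]) (xi \in Xi) * #|X| ^ 4)%N.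
    rewrite -big_distrl /= -sum1_card big_mkcond [in RHS]big_mkcond /=; congr (_ * _)%N.
    apply: eq_bigr => xi _; rewrite in_setC1; case: eqP => [->|] //=.
    by rewrite (negPf Xi0).
  rewrite -big_split /=; apply: leq_sum => xi _.
  have := CS xi; case: (boolP (xi \in Xi)) => [Xxi|_] h; last first.
    by rewrite mul0n addn0 (leq_trans h) // leq_mul // max_card.
  have := small xi; rewrite /= Xxi /= => /negbT; rewrite -leqNgt => h2.
  by rewrite mul1n addnn -mul2n (leq_trans (leq_mul (leqnn 2) h)) // mulnA leq_mul.
have := leq_trans lowE (leq_mul (leqnn q) sumE).
have q0 : (0 < q)%N by apply/card_gt0P; exists 0.
have X0 : (0 < #|X| ^ 2)%N.
  by rewrite lt0n; apply: contraTneq big => ->; rewrite muln0.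
have -> : (#|X| ^ 4 = #|X| ^ 2 * #|X| ^ 2)%N by rewrite -expnD.
rewrite mulnA -mulnDl mulnA leq_pmul2r // => h.
move: big; rewrite ltnNge => /negP[]; rewrite -(leq_add2l (q.-1 * #|X| ^ 2)) -mulnDl.
apply: leq_trans h _; rewrite -mulnn; case: (q) q0 => // r _ /=; lia.
Qed.
End Affine.

Lemma eq_pairs (S T : Type) (p r : S * T) : p = r -> p.1 = r.1 /\ p.2 = r.2.
Proof. by move=> ->. Qed.

(** * Second moment of the action on cosets *)

Section Mixing.
Variables (gT : finGroupType) (G B : {group gT}) (T : finType) (d : gT -> T) (E : {set T}).
Local Open Scope group_scope.
Implicit Types (b k l w y z : gT) (W Y Z : {set gT}).
Hypothesis sBG : B \subset G.
Hypothesis dE : {in B, forall b, d b \in E}.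
Hypothesis sect : forall l k b b', l \in G -> k \in G -> b \in B -> b' \in B ->
  k \notin B -> l^-1 * b * k \in B -> l^-1 * b' * k \in B -> d b = d b' -> b = b'.

Lemma card_close_pairs Y : #|[set p in setX Y Y | p.1^-1 * p.2 \in B]| <= #|B| * #|Y|.
Proof.
apply: (@card_le_fibres _ _ fst) => [[y y']|y Yy].
  by rewrite in_set => /andP[/setXP[]].
set L := finset _; have LP p : p \in L -> p.1 = y /\ y^-1 * p.2 \in B.
  by rewrite in_set => /andP[+ /eqP e]; rewrite in_set e => /andP[].
have inj : {in L &, injective (fun p => y^-1 * p.2)}.
  by move=> [a b] [a' b'] /LP[/= -> _] /LP[/= -> _] /mulgI ->.
rewrite -(card_in_imset inj); apply/subset_leq_card/subsetP => _ /imsetP[p Ep ->].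
by case: (LP p Ep).
Qed.

(* Second moment over [w] of the number of [(y, z)] with [w y B = z B]; it uses
   only the double transitivity of [G] on [G / B], in the form [sect]. *)
Lemma mixing W Y Z n : W \subset G -> Y \subset G -> Z \subset G -> #|Y| = n -> #|Z| = n ->
  {in W & Y & Z, forall w y z, z^-1 * w * y \notin B} ->
  (n * n * #|B|) ^ 2 <=
  (#|G| - #|W|) * (#|E| * (n * n * (n * n)) + #|B| * (#|B| * n * (#|B| * n))).
Proof.
move=> sWG sYG sZG Yn Zn sep.
pose D := [set p in setX G (setX Y Z) | p.2.2^-1 * p.1 * p.2.1 \in B].
have DP p : p \in D -> [/\ p.1 \in G, p.2.1 \in Y, p.2.2 \in Z & p.2.2^-1 * p.1 * p.2.1 \in B].
  by case: p => w [y z]; rewrite in_set => /andP[/setXP[Gw /setXP[]]].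
have lowD : n * n * #|B| <= #|D|.
  rewrite -{1}Yn -Zn -!cardsX.
  pose f (r : (gT * gT) * gT) := (r.1.2 * r.2 * r.1.1^-1, r.1).
  have inj : injective f.
    move=> [[y z] b] [[y' z'] b'] /eq_pairs[/= e /eq_pairs[/= ey ez]].
    by move: e; rewrite ey ez => /mulIg/mulgI ->.
  rewrite -(card_imset _ inj); apply/subset_leq_card/subsetP => _ /imsetP[[[y z] b] + ->].
  rewrite in_setX in_setX => /andP[/andP[Yy Zz] Bb].
  have [Gy Gz] : y \in G /\ z \in G by rewrite (subsetP sYG) ?(subsetP sZG).
  have Gb : b \in G by apply: subsetP sBG _ Bb.
  have Gw : z * b * y^-1 \in G by apply: groupM; [apply: groupM | rewrite groupV].
  have e : z^-1 * (z * b * y^-1) * y = b by rewrite -!mulgA mulVg mulg1 mulKg.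
  rewrite /f /=; apply/setIdP; split; last by rewrite /= e.
  by apply/setXP; split=> //; apply/setXP.
apply: leq_trans (_ : #|D| ^ 2 <= _); first by rewrite leq_exp2r.
(* Separation keeps W out of the range of w, so Cauchy-Schwarz only pays for [#|G| - #|W|] values;
   this saving is the whole gain. *)
have imD p : p \in D -> p.1 \in G :\: W.
  move=> Dp; have [Gp Yp Zp Bp] := DP p Dp; rewrite in_setD Gp andbT.
  by apply/negP => Wp; case/negP: (sep _ _ _ Wp Yp Zp).
apply: leq_trans (collision_bound imD) _.
rewrite cardsD (setIidPr sWG) leq_mul //; set C := finset _.
pose r4 (p : (gT * (gT * gT)) * (gT * (gT * gT))) :=
  ((p.1.2.1, p.2.2.1), (p.1.2.2, p.2.2.2)).
pose K := [set p : (gT * (gT * gT)) * (gT * (gT * gT)) |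
  p.1.2.1^-1 * p.2.2.1 \in B].
have CP p : p \in C -> [/\ p.1 \in D, p.2 \in D & p.1.1 = p.2.1].
  by case: p => a b; rewrite in_set => /andP[/setXP[Da Db] /eqP].
have eqw p : p \in C -> p.2.2.2^-1 * p.2.1 * p.2.2.1 =
   (p.1.2.2^-1 * p.2.2.2)^-1 * (p.1.2.2^-1 * p.1.1 * p.1.2.1) * (p.1.2.1^-1 * p.2.2.1).
  by case/CP=> _ _ ->; rewrite invMg invgK -!mulgA !mulKVg.
have r4inj p p' : p \in C -> p' \in C -> r4 p = r4 p' ->
    p.1.2.2^-1 * p.1.1 * p.1.2.1 = p'.1.2.2^-1 * p'.1.1 * p'.1.2.1 -> p = p'.
  case: p p' => [[w [y z]] [w1 [y1 z1]]] [[w' [y' z']] [w1' [y1' z1']]].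
  move=> /CP[_ _ /= <-] /CP[_ _ /= <-] /eq_pairs[/eq_pairs[/= -> ->] /eq_pairs[/= -> ->]] e.
  by move/mulIg/mulgI: e => ->.
(* If y and y' lie in different cosets of B, [sect] leaves at most [#|E|] values of w. If they lie
   in the same coset, so do z and z', and [card_close_pairs] bounds these quadruples. *)
rewrite -(cardsID K C) addnC leq_add //.
  have -> : (n * n * (n * n))%N = #|setX (setX Y Y) (setX Z Z)| by rewrite !cardsX Yn Zn.
  apply: (@card_le_fibres _ _ r4).
    move=> p /setDP[/CP[/DP[_ Y1 Z1 _] /DP[_ Y2 Z2 _] _] _].
    by rewrite !in_setX Y1 Y2 Z1 Z2.
  move=> t _; set L := finset _.
  have LP p : p \in L -> [/\ p \in C, p \notin K & r4 p = t].
    by rewrite in_set => /andP[/setDP[? ?] /eqP].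
  have inj : {in L &, injective (fun p => d (p.1.2.2^-1 * p.1.1 * p.1.2.1))}.
    move=> p p' /LP[Cp nKp tp] /LP[Cp' nKp' tp'] e; apply: r4inj => //; first by rewrite tp.
    have [/DP[_ Y1 Z1 B1] /DP[_ Y2 Z2 B2] _] := CP p Cp.
    have [/DP[_ _ _ B1'] /DP[_ _ _ B2'] _] := CP p' Cp'.
    have /eq_pairs[/eq_pairs[/= e1 e2] /eq_pairs[/= e3 e4]] : r4 p = r4 p' by rewrite tp.
    rewrite eqw // in B2; rewrite eqw // in B2'.
    rewrite -e1 -e2 -e3 -e4 in B2' B1' e *.
    have GY y : y \in Y -> y \in G by apply: subsetP.
    have GZ z : z \in Z -> z \in G by apply: subsetP.
    apply: sect B1 B1' _ B2 B2' e.
    - by apply: groupM; rewrite ?groupV GZ.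
    - by apply: groupM; rewrite ?groupV GY.
    - by move: nKp; rewrite in_set.
  rewrite -(card_in_imset inj); apply/subset_leq_card/subsetP => _ /imsetP[p /LP[Cp _ _] ->].
  by have [/DP[_ _ _ /dE]] := CP p Cp.
pose cl X := [set p in setX X X | p.1^-1 * p.2 \in B].
apply: (@leq_trans (#|B| * (#|cl Y| * #|cl Z|))); last first.
  have := card_close_pairs Y; have := card_close_pairs Z; rewrite Yn Zn => cZ cY.
  exact: leq_mul (leqnn _) (leq_mul cY cZ).
rewrite -cardsX; apply: (@card_le_fibres _ _ r4) => [p /setIP[Cp]|t _].
  rewrite in_set => k1; have e := eqw p Cp; have [/DP[_ Y1 Z1 B1] /DP[_ Y2 Z2 B2] _] := CP p Cp.
  apply/setXP; split; apply/setIdP; split=> //; try by apply/setXP.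
  have -> : p.1.2.2^-1 * p.2.2.2 =
     (p.1.2.2^-1 * p.1.1 * p.1.2.1) * (p.1.2.1^-1 * p.2.2.1) * (p.2.2.2^-1 * p.2.1 * p.2.2.1)^-1.
    by rewrite e !invMg !invgK !mulgA !(mulgK, mulgV, mul1g, mulgKV).
  by rewrite groupM ?groupV // groupM.
set L := finset _; have LP p : p \in L -> p \in C /\ r4 p = t.
  by rewrite in_set => /andP[/setIP[? _] /eqP].
have inj : {in L &, injective (fun p => p.1.2.2^-1 * p.1.1 * p.1.2.1)}.
  by move=> p p' /LP[Cp tp] /LP[Cp' tp'] e; apply: r4inj => //; rewrite tp.
rewrite -(card_in_imset inj); apply/subset_leq_card/subsetP => _ /imsetP[p Lp ->].
by have [/CP[/DP[]]] := LP p Lp.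
Qed.
End Mixing.

(** * The Borel subgroup and the projective line *)

Section Borel.
Variable F : finFieldType.
Local Open Scope group_scope.
Local Notation q := #|F|.
Local Notation G := (SL2_sub F).
Implicit Types u v w y z : GL2 F.
Implicit Types W Y Z : {set GL2 F}.

Definition borel_set : {set GL2 F} := [set u in G | ec u == 0%R].

Lemma borelP u : reflect (u \in G /\ ec u = 0%R) (u \in borel_set).
Proof. by apply: (iffP setIdP) => -[Gu /eqP]. Qed.

Lemma borel_group_set : group_set borel_set.
Proof.
apply/group_setP; split=> [|u v /borelP[Gu cu] /borelP[Gv cv]].
  by apply/borelP; split; [apply: group1 | apply: ec1].
by apply/borelP; split; [apply: groupM | rewrite ecM cu cv mul0r mulr0 addr0].
Qed.

Definition borel : {group GL2 F} := Group borel_group_set.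

Lemma mem_borel u : (u \in borel) = (u \in G) && (ec u == 0%R).
Proof. exact: in_set. Qed.

Lemma borel_ea u : u \in borel -> ea u != 0%R /\ ed u = (ea u)^-1%R.
Proof.
rewrite mem_borel => /andP[Gu /eqP c0]; have := inSL2P Gu.
rewrite c0 mulr0 addr0 => e; have a0 : ea u != 0%R.
  by apply: contra_eq_neq e => ->; rewrite mul0r eq_sym oner_neq0.
by split=> //; apply: (mulfI a0); rewrite e divff.
Qed.

Lemma borel_ext u v : u \in borel -> v \in borel -> ea u = ea v -> eb u = eb v -> u = v.
Proof.
move=> Bu Bv a b; have [_ du] := borel_ea Bu; have [_ dv] := borel_ea Bv.
move: Bu Bv; rewrite !mem_borel => /andP[_ /eqP cu] /andP[_ /eqP cv].
by apply: GL2P; rewrite // ?cu ?cv // du dv a.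
Qed.

Lemma card_borel : #|borel| = (q.-1 * q)%N.
Proof.
have inj : {in borel &, injective (fun u => (ea u, eb u))}.
  by move=> u v Bu Bv [a b]; apply: borel_ext.
rewrite -(card_in_imset inj) -(cardsC1 (0%R : F)) -[X in (_ * X)%N]cardsT -cardsX.
apply: eq_card => -[a b]; rewrite in_setX in_setT in_setC1 andbT; apply/imsetP/idP.
  by case=> u /borel_ea[a0 _] [-> _].
move=> a0; have [|u Gu [ua ub uc ud]] := @SL2_ex F a b 0%R a^-1%R.
  by rewrite divff // mulr0 subr0.
by exists u; rewrite ?ua ?ub // mem_borel Gu uc eqxx.
Qed.

(** The image of infinity under [u] on the projective line, [None] being infinity; its fibres in G
    are the left cosets of [borel]. *)
Definition pt u : option F := if ec u == 0%R then None else Some (ea u / ec u)%R.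

Lemma pt_eq u v : u \in G -> v \in G -> pt u = pt v -> u^-1 * v \in borel.
Proof.
move=> Gu Gv; rewrite mem_borel groupM ?groupV //= ecM (ecV Gu) (edV Gu) /pt.
have [->|cu] := eqVneq (ec u) 0%R; have [->|cv] := eqVneq (ec v) 0%R => //.
  by move=> _; rewrite oppr0 mul0r mulr0 addr0.
case=> e; rewrite addrC mulNr subr_eq0; apply/eqP.
by rewrite -[ea u](divfK cu) e mulrAC divfK // mulrC.
Qed.

Lemma card_pt : #|[set: option F]| = q.+1.
Proof. by rewrite cardsT card_option. Qed.

Lemma card_SL2_le : #|G| <= #|borel| * q.+1.
Proof.
rewrite -card_pt; apply: (@card_le_fibres _ _ pt) => // t _; set E := finset _.
case: (pickP (mem E)) => [u|E0]; last by rewrite eq_card0.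
rewrite /= in_set => /andP[Gu /eqP tu].
rewrite -(card_imset _ (mulgI u^-1)); apply/subset_leq_card/subsetP => _ /imsetP[v + ->].
by rewrite [_ \in E]in_set => /andP[Gv /eqP tv]; apply: pt_eq; rewrite ?tu ?tv.
Qed.

(* [b] is recovered from its diagonal once [l^-1 * b * k] is upper triangular. *)
Lemma borel_section l k b b' : l \in G -> k \in G -> b \in borel -> b' \in borel ->
  k \notin borel -> l^-1 * b * k \in borel -> l^-1 * b' * k \in borel ->
  ea b = ea b' -> b = b'.
Proof.
move=> Gl Gk Bb Bb' nk h h' e; apply: borel_ext => //.
have [a0 db] := borel_ea Bb; have [_ db'] := borel_ea Bb'.
move: Bb Bb' h h' nk; rewrite !mem_borel Gk => /andP[_ /eqP cb] /andP[_ /eqP cb'].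
rewrite -!mulgA !ecM !eaM (ecV Gl) (edV Gl) cb cb' db db' e !mul0r !add0r.
move=> /andP[_ /eqP h] /andP[_ /eqP h'] kc.
have lc : ec l != 0%R.
  apply: contraNneq kc => lc; move/eqP: h; rewrite lc oppr0 mul0r add0r.
  have la : ea l != 0%R.
    apply/eqP => la; move: (inSL2P Gl); rewrite la lc mul0r mulr0 addr0 => /eqP.
    by rewrite eq_sym oner_eq0.
  by rewrite !mulf_eq0 (negPf la) invr_eq0 -e (negPf a0).
apply: (mulIf (mulf_neq0 lc kc)).
apply: (eq_by_sub (c := (- 1)%R) (p := ((- ec l * (ea b' * ea k + eb b * ec k) + ea l * ((ea b')^-1 * ec k)) -
  (- ec l * (ea b' * ea k + eb b' * ec k) + ea l * ((ea b')^-1 * ec k)))%R)).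
  by rewrite h h' subrr.
by ring.
Qed.

End Borel.

(** After division by n^2 the main terms n^2 b^2, with b = q (q - 1), cancel. The [n] missing
    elements leave n^3 <= q^2 n^2 + 2 q^8, where the first term is at most half of n^3 once n > 2
    q^2. *)
Lemma mixing_arith q n G :
  0 < q.-1 -> 0 < n -> n <= G -> G <= q.-1 * q * q.+1 ->
  (n * n * (q.-1 * q)) ^ 2 <= (G - n) *
    (q.-1 * (n * n * (n * n)) + q.-1 * q * (q.-1 * q * n * (q.-1 * q * n))) ->
  n ^ 3 <= 32 * q ^ 8.
Proof.
case: q => // r /=; set q := r.+1; set b := r * q => r0 n0 nG Gb h.
pose S := r * n ^ 2 + b ^ 3.
have h1 : n ^ 2 * b ^ 2 <= (G - n) * S.
  rewrite -(leq_pmul2l (_ : 0 < n ^ 2)) ?expn_gt0 ?n0 //.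
  by apply: leq_trans (leq_trans (eq_leq _) h) (eq_leq _); rewrite /S; ring.
have h2 : n ^ 2 * b ^ 2 + n * S <= b * q.+1 * S.
  apply: (@leq_trans (G * S)); last by rewrite leq_mul.
  by rewrite -[X in _ <= X * S](subnK nG) mulnDl leq_add2r.
have h3 : r * n ^ 3 <= r * (b * n ^ 2 + b ^ 3 * q * q.+1).
  rewrite -(leq_add2l (n ^ 2 * b ^ 2 + n * b ^ 3)).
  apply: leq_trans (leq_trans (eq_leq _) h2) _; first by rewrite /S; ring.
  by apply: (@leq_trans (n ^ 2 * b ^ 2 + r * (b * n ^ 2 + b ^ 3 * q * q.+1)));
    [apply: eq_leq; rewrite /S /b /q; ring | rewrite leq_add2r leq_addr].
rewrite leq_pmul2l // in h3.
have bq : b <= q ^ 2 by rewrite -mulnn leq_mul.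
have q1 : q * q.+1 <= 2 * q ^ 2 by rewrite /q; lia.
have h4 : n ^ 3 <= q ^ 2 * n ^ 2 + 2 * q ^ 8.
  apply: leq_trans h3 (leq_add (leq_mul bq (leqnn _)) _).
  have b3 : b ^ 3 <= (q ^ 2) ^ 3 by rewrite leq_exp2r.
  by rewrite -mulnA; apply: leq_trans (leq_mul b3 q1) (eq_leq _); ring.
have [nq|qn] := leqP n (2 * q ^ 2).
  have n3 : n ^ 3 <= (2 * q ^ 2) ^ 3 by rewrite leq_exp2r.
  apply: leq_trans n3 _; rewrite expnMn -expnM; apply: (@leq_trans (8 * q ^ 8)).
    by rewrite leq_mul // leq_pexp2l.
  by rewrite leq_mul.
have h5 : 2 * q ^ 2 * n ^ 2 <= n ^ 3 by rewrite (expnS n 2) leq_mul // ltnW.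
by lia.
Qed.

Section ReturnToBorel.
Variable F : finFieldType.
Local Open Scope group_scope.
Local Notation q := #|F|.
Local Notation G := (SL2_sub F).
Implicit Types g h u v w y z : GL2 F.
Implicit Types A Q : {set GL2 F}.

(** [mixing] is applied to W = A, Y = A g and Z = A^-1: as it inverts the elements of Z, z^-1 w y is
    a positive word of length 3 followed by g, and failure of the claim is the separation
    hypothesis. *)
Lemma return_to_borel A g : A \subset G -> g \in G -> (32 * q ^ 8 < #|A| ^ 3)%N ->
  exists2 y, y \in A ^+ 3 & y * g \in borel F.
Proof.
move=> sAG Gg big.
case: (pickP [pred y in A ^+ 3 | y * g \in borel F]) => [y /andP[]|none]; first by exists y.
have n0 : (0 < #|A|)%N by rewrite lt0n; apply: contraTneq big => ->; rewrite exp0n.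
have := @mixing _ G (borel F) F (@ea F) [set~ 0%R] _ _ _
  A (A :* g) A^-1 #|A| sAG.
rewrite cardsC1 card_borel card_rcoset card_invg => h.
suff : (#|A| ^ 3 <= 32 * q ^ 8)%N by rewrite leqNgt big.
have q1 : (0 < q.-1)%N.
  by have := card_finNzRing_gt1 F; case: #|F| => [|[|]].
apply: mixing_arith q1 n0 (subset_leq_card sAG) _ _.
  by have := card_SL2_le F; rewrite card_borel.
apply: h.
- by apply/subsetP=> u; rewrite mem_borel => /andP[].
- by move=> b /borel_ea[b0 _]; rewrite in_setC1.
- exact: borel_section.
- by apply/subsetP=> _ /rcosetP[a Aa ->]; apply: groupM => //; apply: subsetP Aa.
- by rewrite -(invGid G) invSg.
- exact: erefl.
- exact: erefl.
move=> w _ z Aw /rcosetP[a Aa ->]; rewrite mem_invg => Az.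
have := none (z^-1 * w * a); rewrite /= !mulgA.
have -> /= : z^-1 * w * a \in A ^+ 3.
  by apply: (@expgsD _ _ 2 1); rewrite ?expg1 //; apply: (@expgsD _ _ 1 1); rewrite ?expg1.
by move=> ->.
Qed.
End ReturnToBorel.

Lemma meet_of_large (T : finType) (X Y : {set T}) : #|T| < #|X| + #|Y| ->
  exists2 x, x \in X & x \in Y.
Proof.
move=> big; have /card_gt0P[x /setIP[Xx Yx]] : 0 < #|X :&: Y|; last by exists x.
by rewrite -(ltn_add2l #|X :|: Y|) addn0 cardsUI (leq_ltn_trans _ big) // max_card.
Qed.

(** Here x = |X| and k = |Xi|: n <= 2 q^2 x and n <= 4 q^2 k, so n^3 > 32 q^8 forces k x^2 > 2
    q^2. *)
Lemma dilation_arith q n m x y k : x <= q -> n <= 2 * q * m -> m <= x * q ->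
  m <= q * y -> y <= 2 * k -> 32 * q ^ 8 < n ^ 3 -> q ^ 2 + x ^ 2 < k * x ^ 2.
Proof.
move=> xq h1 h2 h3 h4 big.
have n1 : n <= 2 * q ^ 2 * x by apply: leq_trans h1 _; rewrite -mulnn; nia.
have n2 : n <= 4 * q ^ 2 * k by apply: leq_trans h1 _; rewrite -mulnn; nia.
have n3 : n ^ 3 <= 16 * q ^ 6 * (k * x ^ 2).
  rewrite (_ : n ^ 3 = n * n * n); last by ring.
  apply: leq_trans (leq_mul (leq_mul n1 n1) n2) (eq_leq _); ring.
have : 16 * q ^ 6 * (2 * q ^ 2) < 16 * q ^ 6 * (k * x ^ 2).
  by apply: leq_trans n3; apply: leq_trans big; rewrite ltnS; apply: eq_leq; ring.
rewrite ltn_mul2l => /andP[_]; apply: leq_trans; rewrite ltnS.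
by rewrite mul2n -addnn leq_add2l leq_exp2r.
Qed.

(** * Filling a coset of the unipotent radical *)

Section BorelCosets.
Variable F : finFieldType.
Local Open Scope group_scope.
Local Notation q := #|F|.
Local Notation G := (SL2_sub F).
Local Notation B := (borel F).
Implicit Types u v r : GL2 F.
Implicit Types A Q : {set GL2 F}.

(* The coordinate [x] in the factorisation [[1, x; 0, 1] * diag (a, a^-1)]. *)
Definition ux u : F := (ea u * eb u)%R.

Lemma borel_ec u : u \in B -> ec u = 0%R.
Proof. by rewrite mem_borel => /andP[_ /eqP]. Qed.

Lemma borel_eaM u v : v \in B -> ea (u * v) = (ea u * ea v)%R.
Proof. by move=> Bv; rewrite eaM (borel_ec Bv) mulr0 addr0. Qed.

Lemma uxM u v : v \in B -> ux (u * v) = (ux u + ea u ^+ 2 * ux v)%R.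
Proof.
move=> Bv; rewrite /ux borel_eaM // ebM; have [a0 ->] := borel_ea Bv; by field.
Qed.

Lemma borel_ux_ext u v : u \in B -> v \in B -> ea u = ea v -> ux u = ux v -> u = v.
Proof.
move=> Bu Bv a; have [a0 _] := borel_ea Bu; rewrite /ux -a => /(mulfI a0).
exact: borel_ext.
Qed.

(** Let X be the [ux]-values of the elements of [Q] with a popular diagonal entry l0. A word u v u'
    with u, u' among these has its [ux] in a translate of X + xi X, with xi depending only on [v];
    some [v] makes this more than half of F. Two such words then reach every [ux], in 3 + 3
    letters. *)
Lemma borel_full_coset Q n : Q \subset B -> (n <= 2 * q * #|Q|)%N -> (32 * q ^ 8 < n ^ 3)%N ->
  exists2 m : F, m != 0%R & forall u, u \in B -> ea u = m -> u \in Q ^+ 6.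
Proof.
move=> sQB nQ big.
have QB u : u \in Q -> u \in B by apply: subsetP.
have Q0 : (0 < #|Q|)%N.
  rewrite lt0n; apply: contraTneq big => Q0; move: nQ; rewrite Q0 muln0 leqn0 => /eqP->.
  by rewrite exp0n.
have [l0 _ hl0] := @exists_large_fibre _ _ (@ea F) Q setT (fun _ _ => in_setT _) Q0.
set R := finset _ in hl0; pose X := [set ux u | u in R].
have RP u : u \in R -> u \in Q /\ ea u = l0 by rewrite in_set => /andP[? /eqP].
have cardX : #|X| = #|R|.
  apply: card_in_imset => u v /RP[/QB Bu lu] /RP[/QB Bv lv]; apply: borel_ux_ext => //.
  by rewrite lu lv.
pose D := [set ea u | u in Q].
have hD : (#|Q| <= q * #|D|)%N.
  apply: (@card_le_fibres _ _ (@ea F)) => [u Qu|l _]; first exact: imset_f.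
  rewrite -[X in (_ <= X)%N]cardsT; set E := finset _.
  have EP u : u \in E -> u \in Q /\ ea u = l by rewrite in_set => /andP[? /eqP].
  have inj : {in E &, injective ux}.
    move=> u v /EP[/QB Bu lu] /EP[/QB Bv lv]; apply: borel_ux_ext => //.
    by rewrite lu lv.
  by rewrite -(card_in_imset inj) subset_leq_card // subsetT.
have l00 : l0 != 0%R.
  have /card_gt0P[u /RP[/QB/borel_ea[u0 _] <-]] // : (0 < #|R|)%N.
  by rewrite lt0n; apply: contraTneq Q0 => R0; move: hl0; rewrite R0 mul0n leqn0 => /eqP->.
pose Xi := [set (l0 ^+ 2 * l ^+ 2)%R | l in D].
have hXi : (#|D| <= 2 * #|Xi|)%N.
  apply: (@card_le_fibres _ _ (fun l => (l0 ^+ 2 * l ^+ 2)%R)) => [l Dl|xi _]; first exact: imset_f.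
  apply: leq_trans (card_quadratic 0 (- (xi / l0 ^+ 2)))%R; apply/subset_leq_card/subsetP => l.
  rewrite [_ \in [set _ in _ | _]]in_set => /andP[_ /eqP <-].
  by rewrite in_set mul0r addr0 mulrAC divff ?expf_neq0 // mul1r subrr.
have DP l : l \in D -> l != 0%R by case/imsetP=> u /QB/borel_ea[u0 _] ->.
have Xi0 : 0%R \notin Xi.
  apply/imsetP => -[l /DP l1 /eqP]; rewrite eq_sym.
  by rewrite mulf_eq0 !expf_eq0 (negPf l00) (negPf l1).
have [|xi /imsetP[_ /imsetP[v Qv ->] exi] hS] := @exists_large_dil_sum F X Xi Xi0.
  rewrite cardX; apply: dilation_arith nQ _ hD hXi big; last by rewrite -cardsT.
  by rewrite -cardX max_card.
set S := dil_sum X xi in hS; have Bv := QB v Qv.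
pose t := (l0 * ea v * l0)%R; pose c := (l0 ^+ 2 * ux v)%R.
have t0 : t != 0%R by rewrite !mulf_neq0 //; case: (borel_ea Bv).
have hR s : s \in S -> exists r, [/\ r \in Q ^+ 3, r \in B, ea r = t & ux r = (s + c)%R].
  case/imsetP=> -[_ _] /setXP[/imsetP[u /RP[Qu lu] ->] /imsetP[u' /RP[Qu' lu'] ->]] /= ->.
  have Bu := QB u Qu; have Bu' := QB u' Qu'.
  exists (u * (v * u')); split.
  - by apply: (@expgsD _ _ 1 2); rewrite ?expg1 //; apply: (@expgsD _ _ 1 1); rewrite ?expg1.
  - exact: (groupM Bu (groupM Bv Bu')).
  - by rewrite !borel_eaM ?groupM // lu lu' /t mulrA.
  - by rewrite !uxM ?groupM // lu exi /c; ring.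
exists (t ^+ 2)%R; first by rewrite expf_neq0.
move=> u Bu eu.
pose f s := (ux u - c - t ^+ 2 * (s + c))%R.
have injf : injective f.
  move=> s s' e; apply: (addIr c); apply: (mulfI (expf_neq0 2 t0)).
  by apply: (eq_by_sub (c := (- 1)%R) (p := (f s - f s')%R)); [rewrite e subrr | rewrite /f; ring].
have [|s Ss /imsetP[s' Ss' es]] := @meet_of_large _ S [set f s | s in S].
  by rewrite (card_imset _ injf) addnn -mul2n.
have [r [Q3 Br er xr]] := hR s Ss; have [r' [Q3' Br' er' xr']] := hR s' Ss'.
suff -> : u = r * r' by apply: (@expgsD _ _ 3 3).
apply: borel_ux_ext; rewrite ?groupM //; first by rewrite borel_eaM // er er' eu expr2.
by rewrite uxM // xr xr' er es /f; ring.
Qed.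

End BorelCosets.

(** * Covering the group through the Bruhat decomposition *)

Section EndState.
Variable F : finFieldType.
Local Open Scope group_scope.
Local Notation q := #|F|.
Local Notation G := (SL2_sub F).
Local Notation B := (borel F).
Implicit Types g h k u v w : GL2 F.
Implicit Types A Q : {set GL2 F}.

Lemma borel_ex (m b : F) : m != 0%R -> exists2 u, u \in B & ea u = m /\ eb u = b.
Proof.
move=> m0; have [|u Gu [ua ub uc _]] := @SL2_ex F m b 0%R m^-1%R.
  by rewrite divff // mulr0 subr0.
by exists u; rewrite // mem_borel Gu uc eqxx.
Qed.

(** With both diagonals equal to (m, m^-1), [ec (u * h * v) = ec h], while the upper right entries
    of [u] and [v] adjust [ea] and [ed] separately; [eb] is then forced by the determinant. *)
Lemma bruhat_sandwich (m : F) h w : m != 0%R -> h \in G -> w \in G -> ec h != 0%R ->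
  ec w = ec h ->
  exists u v, [/\ u \in B, v \in B, ea u = m, ea v = m & w = u * h * v].
Proof.
move=> m0 Gh Gw c0 cw.
have [v Bv [va vb]] := borel_ex ((m * ed w - ed h / m) / ec h)%R m0.
have [u Bu [ua ub]] := borel_ex ((ea w - m ^+ 2 * ea h) / (ec h * m))%R m0.
have [_ vd] := borel_ea Bv; have [_ ud] := borel_ea Bu.
have dw := inSL2P Gw.
exists u, v; split=> //.
have GB x : x \in B -> x \in G by rewrite mem_borel => /andP[].
have Gx : u * h * v \in G by apply: groupM (groupM (GB u Bu) Gh) (GB v Bv).
have xa : ea (u * h * v) = ea w.
  by rewrite !(eaM, ebM, ecM, edM) (borel_ec Bv) ua ub va; field; rewrite m0 c0.
have xc : ec (u * h * v) = ec w.
  by rewrite !(eaM, ebM, ecM, edM) (borel_ec Bu) (borel_ec Bv) ud ua va cw; field; rewrite m0.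
have xd : ed (u * h * v) = ed w.
  by rewrite !(eaM, ebM, ecM, edM) (borel_ec Bu) ud vd ua va vb; field; rewrite m0 c0.
apply: GL2P => //; apply: (mulIf (_ : ec w != 0%R)); first by rewrite cw.
have := inSL2P Gx; rewrite xa xc xd dw => e.
exact: (addrI 1%R).
Qed.

Lemma exists_ec_neq0 A : <<A>> = G -> exists2 h, h \in A & ec h != 0%R.
Proof.
move=> genA; case: (pickP [pred h in A | ec h != 0%R]) => [h /andP[]|none]; first by exists h.
have sAB : G \subset B.
  rewrite -genA gen_subG; apply/subsetP=> h Ah; rewrite mem_borel.
  have Gh : h \in G by rewrite -genA mem_gen.
  by have := none h; rewrite Gh /= Ah => /negbFE.
have [|u Gu [_ _ uc _]] := @SL2_ex F 1%R 0%R 1%R 1%R; first by rewrite mulr1 mul0r subr0.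
by have := subsetP sAB u Gu; rewrite mem_borel Gu uc oner_eq0.
Qed.

(** 196 = 2 * 2 * (24 + 1 + 24): six elements of [A ^+ 4] fill a unipotent coset; two of these
    around [h] give every w with [ec w = ec h]; two such factors give [ec w] nonzero, and two of
    those everything. *)
Lemma large_end_state A : 1 \in A -> <<A>> = G -> (32 * q ^ 8 < #|A| ^ 3)%N ->
  A ^+ 196 = G.
Proof.
move=> A1 genA big; have sAG : A \subset G by rewrite -genA subset_gen.
have n0 : (0 < #|A|)%N by rewrite lt0n; apply: contraTneq big => ->; rewrite exp0n.
have q0 : (0 < q)%N by apply/card_gt0P; exists 0%R.
have [t _] := @exists_large_fibre _ _ (@pt F) A setT (fun _ _ => in_setT _) n0.
rewrite card_pt; set D := finset _ => hD.
have DP g : g \in D -> g \in A /\ pt g = t by rewrite in_set => /andP[? /eqP].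
have /card_gt0P[g Dg] : (0 < #|D|)%N.
  by rewrite lt0n; apply: contraTneq n0 => D0; move: hD; rewrite D0 mul0n leqn0 => /eqP->.
have [Ag tg] := DP g Dg; have Gg := subsetP sAG g Ag.
have [y A3y Byg] := return_to_borel sAG Gg big.
(* [D] lies in the single coset g B, so y D lies in B; only a factor q + 1 <= 2 q is lost to the
   pigeonhole. *)
pose Q := [set y * d | d in D].
have sQB : Q \subset B.
  apply/subsetP=> _ /imsetP[d /DP[Ad td] ->].
  rewrite -(mulKVg g d) mulgA; apply: groupM => //.
  by apply: pt_eq; rewrite ?tg ?td // (subsetP sAG).
have sQA : Q \subset A ^+ 4.
  by apply/subsetP=> _ /imsetP[d /DP[Ad _] ->]; apply: (@expgsD _ _ 3 1); rewrite ?expg1.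
have cQ : (#|A| <= 2 * q * #|Q|)%N.
  rewrite (card_imset _ (mulgI y)); apply: leq_trans hD _.
  by rewrite mulnC leq_mul // mul2n -addnn -addn1 leq_add2l.
have [m m0 full] := borel_full_coset sQB cQ big.
have full24 u : u \in B -> ea u = m -> u \in A ^+ 24.
  move=> Bu eu; have := full u Bu eu; apply: subsetP.
  by rewrite (_ : 24 = 4 * 6)%N // expgM expgs_mono.
have [h Ah ch] := exists_ec_neq0 genA; have Gh := subsetP sAG h Ah.
have full49 w : w \in G -> ec w = ec h -> w \in A ^+ 49.
  move=> Gw cw; have [u [v [Bu Bv ua va ->]]] := bruhat_sandwich m0 Gh Gw ch cw.
  apply: (@expgsD _ _ 25 24); last exact: full24.
  by apply: (@expgsD _ _ 24 1); [apply: full24 | rewrite expg1].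
have full98 w : w \in G -> ec w != 0%R -> w \in A ^+ 98.
  move=> Gw cw.
  (* The upper left entry of [k] solves [ec (k^-1 * w) = ec h], which is linear in it; both factors
     are then covered by [full49]. *)
  have [|k Gk [ka kb kc kd]] := @SL2_ex F (ec h * (1 + ea w) / ec w)%R (- (ec h)^-1)%R (ec h) 0%R.
    by rewrite mulr0 sub0r mulNr opprK mulVf.
  rewrite -(mulKVg k w); apply: (@expgsD _ _ 49 49); apply: full49 => //.
    by apply: groupM => //; rewrite groupV.
  by rewrite ecM ecV // edV // ka kc; field.
apply/eqP; rewrite eqEsubset expgs_sub_group //; apply/subsetP=> w Gw.
have [cw|cw] := eqVneq (ec w) 0%R; last first.
  by apply: subsetP (full98 w Gw cw); apply: expgs_subset.
have [|k Gk [ka kb kc kd]] := @SL2_ex F 0%R (- 1)%R 1%R 0%R.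
  by rewrite mulr0 sub0r mulr1 opprK.
rewrite -(mulKVg k w); apply: (@expgsD _ _ 98 98); apply: full98 => //.
- by rewrite kc oner_eq0.
- by apply: groupM => //; rewrite groupV.
rewrite ecM ecV // edV // ka kc mul0r addr0 mulN1r oppr_eq0.
apply/eqP => aw; have := inSL2P Gw; rewrite aw mul0r cw mulr0 addr0 => /eqP.
by rewrite eq_sym oner_eq0.
Qed.
End EndState.

(** * Iteration *)

Section LinearGrowth.
Variables (gT : finGroupType) (A : {set gT}).
Hypothesis A1 : (1 \in A)%g.
Local Open Scope group_scope.

Lemma gen_eq_expgs : exists k, <<A>> = A ^+ k.
Proof.
by have [k ->] := gen_expgs A; exists k; rewrite (setUidPr _) // sub1set.
Qed.

Lemma expgs_stable k : A ^+ k.+1 = A ^+ k -> A ^+ k = <<A>>.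
Proof.
move=> stab; have stabD n : A ^+ (n + k) = A ^+ k.
  by elim: n => [//|n IHn]; rewrite addSn expgS IHn -expgS.
have [n gn] := gen_eq_expgs; apply/eqP; rewrite eqEsubset expgs_sub_group ?subset_gen //=.
by rewrite gn -(stabD n) expgs_subset // leq_addr.
Qed.

Lemma linear_growth n : A ^+ n = <<A>> \/ n < #|A ^+ n|.
Proof.
elim: n => [|n [IHn|IHn]]; first by right; rewrite expg0 cards1.
  by left; rewrite expgSr IHn; apply/eqP; rewrite eqEsubset mul_subG ?subset_gen //= mulg_subl.
have sn : A ^+ n \subset A ^+ n.+1 by apply: expgs_subset.
have [e|ne] := eqVneq (A ^+ n.+1) (A ^+ n).
  by left; rewrite e; apply: expgs_stable.
by right; apply: leq_ltn_trans IHn (proper_card _); rewrite properEneq eq_sym ne.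
Qed.

Lemma expgs_full k n : A ^+ k = <<A>> -> k <= n -> A ^+ n = <<A>>.
Proof.
move=> full kn; apply/eqP; rewrite eqEsubset expgs_sub_group ?subset_gen //=.
by rewrite -full expgs_subset.
Qed.

End LinearGrowth.

(** In twelfth powers the exponents 11/4 and 8/3 become 33 and 32; the spare factor q absorbs the
    constants. *)
Lemma end_state_arith q n : 16 ^ 3 * 32 ^ 4 <= q -> q ^ 11 < (2 * n) ^ 4 ->
  32 * q ^ 8 < n ^ 3.
Proof.
move=> hq hn; rewrite ltnNge; apply: contraL hn => h; rewrite -leqNgt.
rewrite -(leq_exp2r _ _ (isT : 0 < 3)).
have h4 : (n ^ 3) ^ 4 <= (32 * q ^ 8) ^ 4 by rewrite leq_exp2r.
apply: (@leq_trans (16 ^ 3 * (32 * q ^ 8) ^ 4)).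
  apply: leq_trans (leq_mul (leqnn _) h4); apply: eq_leq.
  by rewrite (expnMn 2) expnMn -!expnM.
apply: (@leq_trans (q * q ^ 32)); last by rewrite -expnS -expnM.
by rewrite (expnMn 32) mulnA -expnM; apply: leq_mul hq (leqnn _).
Qed.

Lemma growth_dichotomy : exists m e, [/\ 1 < m, 0 < e &
  forall (F : finFieldType) (A : {set GL2 F}), (1 \in A)%g -> (<<A>> = SL2_sub F)%g ->
    (A ^+ m = SL2_sub F)%g \/ #|A| ^ e.+1 <= #|(A ^+ m)%g| ^ e].
Proof.
have [C [e [e0 grow]]] := tripling_growth.
(* Behind the existential the numeral 2^32 is never computed in unary. *)
have [Q0 hQ] : exists Q0, 16 ^ 3 * 32 ^ 4 <= Q0 by eexists; apply: leqnn.
(* The summands serve large sets, fields with at most Q0 elements and sets with at most C elements.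
   In the remaining case one of the two surplus powers in [tripling_growth] absorbs C. *)
pose m := 196 + Q0 ^ 3 + C ^ e.+1.
exists m, e; split=> // F A A1 genA.
have mono k : k <= m -> (A ^+ k = SL2_sub F)%g -> (A ^+ m = SL2_sub F)%g.
  by move=> km; rewrite -genA => Ak; apply: expgs_full km.
have [Aem|mA] := linear_growth A1 m; first by left; rewrite Aem.
have [qQ|Qq] := leqP #|F| Q0.
  left; have [e3|] := linear_growth A1 (Q0 ^ 3); first by apply: (mono (Q0 ^ 3)); [rewrite /m addnAC leq_addl | rewrite e3].
  rewrite ltnNge => /negP[]; apply: leq_trans (subset_leq_card (_ : _ \subset SL2_sub F)) _.
    by rewrite expgs_sub_group // -genA subset_gen.
  apply: leq_trans (card_SL2_le F) _; rewrite card_borel.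
  apply: (@leq_trans (#|F| ^ 3)); last by rewrite leq_exp2r.
  by case: #|F| => // r; rewrite /= !expnS expn0 muln1; nia.
have q2 : 2 < #|F|.
  apply: leq_trans Qq; rewrite ltnS; apply: leq_trans hQ.
  by rewrite -[2]muln1; apply: leq_mul; [apply: isT | rewrite expn_gt0].
have [AC|CA] := leqP #|A| C.
  right; apply: leq_trans (leq_exp2rW _ AC) _.
  apply: (@leq_trans #|(A ^+ m)%g|); first by apply: leq_trans (ltnW mA); rewrite /m leq_addl.
  case: (e) e0 => // e' _; rewrite expnS leq_pmulr // expn_gt0.
  by rewrite (leq_ltn_trans _ mA).
have [h|h] := leqP ((2 * #|A|) ^ 4) (#|F| ^ 11); last first.
  left; apply: (@mono 196); first by rewrite /m -addnA leq_addr.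
  by apply: large_end_state => //; apply: end_state_arith h; apply: leq_trans hQ (ltnW Qq).
right; have := grow F A q2 A1 genA h.
have C0 : 0 < #|A| by apply: leq_ltn_trans CA.
rewrite addn2 expnS => g1; rewrite -(leq_pmul2l C0); apply: leq_trans g1 _.
apply: leq_mul; first exact: ltnW.
by apply/leq_exp2rW/subset_leq_card/expgs_subset => //; rewrite /m -!addnA.
Qed.

Lemma iterated_growth m e : 0 < m ->
  (forall (F : finFieldType) (A : {set GL2 F}), (1 \in A)%g -> (<<A>> = SL2_sub F)%g ->
    (A ^+ m = SL2_sub F)%g \/ #|A| ^ e.+1 <= #|(A ^+ m)%g| ^ e) ->
  forall (F : finFieldType) (A : {set GL2 F}), (1 \in A)%g -> (<<A>> = SL2_sub F)%g ->
  forall i, (A ^+ (m ^ i) = SL2_sub F)%g \/ #|A| ^ (e.+1 ^ i) <= #|(A ^+ (m ^ i))%g| ^ (e ^ i).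
Proof.
move=> m0 dich F A A1 genA; elim=> [|i [IHi|IHi]]; first by right; rewrite !expn0 !expn1.
  by left; rewrite -genA; apply: (expgs_full A1) (leq_pexp2l m0 (leqnSn i)); rewrite genA.
have mi0 : 0 < m ^ i by rewrite expn_gt0 m0.
have [full|h] := dich F (A ^+ (m ^ i))%g (mem_expgs1 _ A1) (etrans (gen_expgs_eq A1 mi0) genA).
  by left; rewrite expnSr expgM.
right; rewrite !expnSr expgM !expnM; apply: leq_trans (leq_exp2rW _ IHi) _.
by rewrite -!expnM mulnC (mulnC (e ^ i)) !expnM leq_exp2rW.
Qed.

(** Two unipotents show that SL_2(F) is not abelian. The bound lets every generating set pass the
    test |A| > |G|^delta at the delta for which the right side is the square root of 2. *)
Lemma card_generators_gt1 (F : finFieldType) (S : {set GL2 F}) :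
  (<<S>> = SL2_sub F)%g -> 1 < #|S|.
Proof.
move=> genS; rewrite ltnNge; apply/negP => S1.
have abS : abelian <<S>>%g.
  have [/eqP S0|S0] := posnP #|S|.
    by move: S0; rewrite cards_eq0 => /eqP->; rewrite gen0 abelian1.
  have /cards1P[s ->] : #|S| == 1 by rewrite eqn_leq S1.
  exact: cycle_abelian.
have [|u Gu [_ ub uc _]] := @SL2_ex F 1%R 1%R 0%R 1%R; first by rewrite mulr1 mulr0 subr0.
have [|v Gv [_ vb vc _]] := @SL2_ex F 1%R 0%R 1%R 1%R; first by rewrite mulr1 mul0r subr0.
move: abS; rewrite genS => /centsP/(_ u Gu v Gv) cuv.
have /commuteE[+ _ _] : (u * v == v * u)%g by apply/eqP; exact: cuv.
by rewrite ub vc uc vb mulr1 mulr0 => /eqP; rewrite oner_eq0.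
Qed.

(** j + 1 is the least i for which the power m^i fills G. At j the set is not yet full, so all j
    growth steps took place, which bounds j by the sizes; exponent 1 = m^0 is the case without a
    predecessor. *)
Lemma diameter_dichotomy : exists m e, [/\ 1 < m, 0 < e &
  forall (F : finFieldType) (S : {set GL2 F}), (<<S>> = SL2_sub F)%g ->
  ((1 |: S) ^+ 1 = SL2_sub F)%g \/
  exists2 j, ((1 |: S) ^+ (m ^ j.+1) = SL2_sub F)%g &
    #|S| ^ (e.+1 ^ j) <= #|SL2_sub F| ^ (e ^ j)].
Proof.
have [m [e [m1 e0 dich]]] := growth_dichotomy; exists m, e; split=> // F S genS.
pose A := (1 |: S)%g; have A1 : (1 \in A)%g by apply: setU11.
have genA : (<<A>> = SL2_sub F)%g.
  by rewrite -genS; apply/eqP; rewrite eqEsubset !gen_subG subUset sub1set group1 subset_gen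
    (subset_trans (subsetUr _ _) (subset_gen _)).
have full_ex : exists i, (A ^+ (m ^ i) == SL2_sub F :> {set GL2 F})%g.
  have [k gk] := gen_eq_expgs A1; exists k; apply/eqP; rewrite -genA.
  by apply: (expgs_full A1 (esym gk)); apply: ltnW (ltn_expl _ m1).
case: (ex_minnP full_ex) => -[|j] /eqP full minj; first by left.
right; exists j => //.
have [full'|h] := iterated_growth (ltnW m1) dich A1 genA j.
  by have := minj j; rewrite full' eqxx ltnn => /(_ isT).
have SA : #|S| <= #|A| by apply/subset_leq_card/subsetUr.
apply: leq_trans (leq_exp2rW _ SA) (leq_trans h (leq_exp2rW _ _)).
by apply: subset_leq_card; rewrite expgs_sub_group // -genA subset_gen.
Qed.

(* The bounds with real exponents *)
From mathcomp Require Import all_classical all_reals all_analysis.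
Import Order.TTheory GRing.Theory Num.Theory.
Local Open Scope ring_scope.

Lemma diam_plus_le (gT : finGroupType) (G : {group gT}) (S : {set gT})
  (genS : <<S>>%g = G) k : ((1 |: S) ^+ k = G)%g -> (diam_plus genS <= k)%N.
Proof. by move=> full; rewrite /diam_plus; case: ex_minnP => i _; apply; rewrite full. Qed.

(** Logarithms give delta ln N < ln n and (e + 1)^j ln n <= e^j ln N; the sizes cancel and [delta]
    alone bounds the number of steps. *)
Lemma growth_ratio_lt (R : realType) (n N e j : nat) (delta : R) :
  (1 < n)%N -> (n <= N)%N -> (0 < e)%N -> 0 < delta ->
  (N%:R : R) `^ delta < n%:R -> (n ^ (e.+1 ^ j) <= N ^ (e ^ j))%N ->
  (e.+1%:R / e%:R) ^+ j < delta^-1.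
Proof.
move=> n1 nN e0 d0 hd hj.
have N1 : 1 < N%:R :> R by rewrite ltr1n (leq_trans n1).
have n0 : 0 < n%:R :> R by rewrite ltr0n ltnW.
have N0 : 0 < N%:R :> R by apply: lt_trans N1.
have lN : 0 < ln (N%:R : R) by apply: ln_gt0.
have h1 : delta * ln (N%:R : R) < ln (n%:R : R).
  by rewrite -ln_powR ltr_ln ?posrE ?powR_gt0.
have h2 : ln (n%:R : R) * e.+1%:R ^+ j <= ln (N%:R : R) * e%:R ^+ j.
  rewrite -!natrX !mulr_natr -!lnXn // ler_ln ?posrE ?exprn_gt0 //.
  by rewrite -!natrX ler_nat.
have e1 : 0 < e%:R ^+ j :> R by rewrite exprn_gt0 ?ltr0n.
rewrite expr_div_n ltr_pdivrMr // mulrC ltr_pdivlMr // -(ltr_pM2l lN).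
apply: lt_le_trans h2; rewrite mulrCA [ltLHS]mulrC.
by rewrite ltr_pM2r ?exprn_gt0 // mulrC.
Qed.

Theorem corollary2p2p2 (R : realType) :
  exists C d : R, 0 < C /\ 0 < d /\
    forall (F : finFieldType) (A : {set {'GL_2[F]}})
           (genA : <<A>>%g = SL2 F),
      (diam_plus genA)%:R < C * (log2 (#|SL2 F|%:R : R)) `^ d /\
      forall delta : R, 0 < delta ->
        (#|SL2 F|%:R : R) `^ delta < #|A|%:R ->
        (diam_plus genA)%:R < C * (1 / delta) `^ d.
Proof.
have [m [e [m1 e0 dich]]] := diameter_dichotomy.
(* d is chosen so that r^d = m: the word length m^j is then (r^j)^d, below (1 / delta)^d. *)
pose r : R := e.+1%:R / e%:R; pose d : R := ln m%:R / ln r.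
have r1 : 1 < r by rewrite ltr_pdivlMr ?ltr0n // mul1r ltr_nat.
have r0 : 0 < r by apply: lt_trans r1.
have lr : 0 < ln r by apply: ln_gt0.
have lm : 0 < ln (m%:R : R) by rewrite ln_gt0 // ltr1n.
have d0 : 0 < d by apply: divr_gt0.
have m0 : 0 < m%:R :> R by rewrite ltr0n ltnW.
have rd : r `^ d = m%:R.
  apply: (@ln_inj R); rewrite ?posrE ?powR_gt0 //.
  by rewrite ln_powR /d divfK // gt_eqF.
have sizes (F : finFieldType) (A : {set {'GL_2[F]}}) : <<A>>%g = SL2 F ->
    (1 < #|A|)%N /\ (#|A| <= #|SL2 F|)%N.
  move=> genA; split; first exact: (@card_generators_gt1 F A genA).
  by apply: subset_leq_card; rewrite -genA subset_gen.
have bound (F : finFieldType) (A : {set {'GL_2[F]}}) (genA : <<A>>%g = SL2 F) delta :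
    0 < delta -> (#|SL2 F|%:R : R) `^ delta < #|A|%:R ->
    (diam_plus genA)%:R < 2 * m%:R * (delta^-1) `^ d.
  move=> dl0 hd; have [A1 AG] := sizes F A genA.
  have grow := growth_ratio_lt A1 AG e0 dl0 hd.
  have [full|[j full hj]] := dich F A genA.
    have := @diam_plus_le _ _ _ genA _ full; rewrite -(ler_nat R) => /le_lt_trans; apply.
    (* With no growth step at all, the case j = 0 still says that delta < 1. *)
    have i1 : 1 < delta^-1 by have := grow 0%N; rewrite expr0; apply; rewrite !expn0 !expn1.
    have : 1 <= (delta^-1) `^ d.
      rewrite -(powRr0 (delta^-1)) ler_powR //; exact: ltW.
    have : 1 < m%:R :> R by rewrite ltr1n.
    move: (_ `^ _) => x; nra.
  have := @diam_plus_le _ _ _ genA _ full; rewrite -(ler_nat R) => /le_lt_trans; apply.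
  have rj : (m%:R : R) ^+ j = (r ^+ j) `^ d.
    by rewrite -rd -!powR_mulrn ?powR_ge0 ?ltW // -!powRrM mulrC.
  have lt_rj : (r ^+ j) `^ d < (delta^-1) `^ d.
    apply: gt0_ltr_powR => //; rewrite ?nnegrE ?exprn_ge0 ?ltW ?invr_gt0 //.
    exact: grow.
  rewrite natrX exprS rj -mulrA.
  have p0 : 0 <= (r ^+ j) `^ d by apply: powR_ge0.
  move: (_ `^ _) (_ `^ _) lt_rj p0 => x y xy x0.
  nra.
(* The factor 2^d comes from 1 / delta = 2 log2 |G| in the first bound. *)
pose C : R := 2 * m%:R * 2 `^ d.
have two1 : 1 <= 2 `^ d :> R.
  have := @ler_powR R 2 _ 0 d (ltW d0); rewrite powRr0; apply.
  by rewrite ler1n.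
exists C, d; split; first by rewrite /C !mulr_gt0 ?powR_gt0.
split=> // F A genA; have [A1 AG] := sizes F A genA; split; last first.
  move=> delta dl0 hd; rewrite div1r; apply: lt_le_trans (bound F A genA delta dl0 hd) _.
  rewrite ler_wpM2r ?powR_ge0 // /C ler_peMr // mulr_ge0 // ltW //.
have lg : 0 < ln (#|SL2 F|%:R : R) by rewrite ln_gt0 // ltr1n (leq_trans A1).
have l2 : 0 < ln (2 : R) by rewrite ln_gt0 // ltr1n.
pose L := log2 (#|SL2 F|%:R : R).
have L0 : 0 < L by apply: divr_gt0.
(* [#|G| `^ (1 / (2 log2 #|G|))] is the square root of 2. *)
have := bound F A genA (2 * L)^-1; rewrite invrK powRM ?ler0n ?ltW // mulrA.
apply; first by rewrite invr_gt0 mulr_gt0.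
apply: (@lt_le_trans _ _ 2); last by rewrite ler_nat.
rewrite -ltr_ln ?posrE ?powR_gt0 ?ltr0n ?(leq_trans _ AG) ?(ltnW A1) //.
rewrite ln_powR invfM -mulrA /L /log2 invf_div divfK ?gt_eqF //.
by rewrite mulrC ltr_pdivrMr // ltr_pMr // ltr1n.
Qed.
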